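(* Let $(M,F)$ be a conic pseudo-Finsler surface with $F$ defined on the conic sub-bundle $\mathcal A$, let $\phi:\mathcal A\to\mathbb R$ be a smooth function positively homogeneous of degree $0$ in $y$ with $\sigma+\varepsilon-(\phi_{;2})^2\neq0$ on $\mathcal A$, where $\sigma=\phi_{;2;2}+\varepsilon\mathcal I\phi_{;2}+2(\phi_{;2})^2$, and let $\overline F=e^{\phi}F$. Then the geodesic spray coefficients $\overline G^i$ and $G^i$ of $\overline F$ and $F$ are related by $$\overline G^i=G^i+Q\,m^i+\Big(\tfrac12F^2\phi_{,1}-\varepsilon\phi_{;2}\,Q\Big)\ell^i,$$ where $2Q=\varepsilon\rho F^2(\phi_{;2}\phi_{,1}+\phi_{,1;2}-2\phi_{,2})$ and $\rho=1/(\sigma+\varepsilon-(\phi_{;2})^2)$.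
   Context: Let $M$ be a smooth 2-dimensional manifold, $(x^1,x^2)$ local coordinates and $(x^i,y^i)$ the induced coordinates on $TM$; all formulas are in such a coordinate system and repeated indices are summed over $\{1,2\}$. Write $\partial_i=\partial/\partial x^i$, $\dot\partial_i=\partial/\partial y^i$. A function is $h(r)$ if it is positively homogeneous of degree $r$ in $y$. A conic sub-bundle is a non-empty open subset $\mathcal A\subset TM\setminus 0$ projecting onto $M$ and closed under multiplication by positive scalars. A conic pseudo-Finsler metric on $M$ is a smooth $h(1)$ function $F:\mathcal A\to\mathbb R$ such that $g_{ij}=\tfrac12\dot\partial_i\dot\partial_jF^2$ is non-degenerate at each point of $\mathcal A$; $(g^{ij})$ is the inverse matrix. A conic pseudo-Finsler surface is equipped with its modified Berwald frame: $F$ is nowhere zero on $\mathcal A$, $\ell_i=\dot\partial_iF$, $\ell^i=y^i/F$, $\varepsilon\in\{1,-1\}$ (the signature) is the sign of $\det(g_{ij})$, $m_1=-\sqrt{\varepsilon\det(g_{ij})}\,\ell^2$, $m_2=\sqrt{\varepsilon\det(g_{ij})}\,\ell^1$, $m^i=g^{ij}m_j$; thus $g_{ij}=\ell_i\ell_j+\varepsilon m_im_j$, $\ell^im_i=0$, $m^im_i=\varepsilon$. The main scalar $\mathcal I$ is defined by $F\,C_{ijk}=\mathcal I\,m_im_jm_k$, where $C_{ijk}=\tfrac12\dot\partial_kg_{ij}$. The geodesic spray coefficients of $F$ are $G^i=\tfrac14g^{ij}(y^k\dot\partial_j\partial_kF^2-\partial_jF^2)$; $G^j_i=\dot\partial_iG^j$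 and $\delta_i=\partial_i-G^j_i\dot\partial_j$. $\overline G^i$ is defined in the same way from $\overline F$ (the condition $\sigma+\varepsilon-(\phi_{;2})^2\ne0$ guarantees that $\overline F$ is a conic pseudo-Finsler metric). For a smooth function $f$ on $\mathcal A$: $f_{;2}:=\varepsilon F(\dot\partial_if)m^i$, $f_{,1}:=(\delta_if)\ell^i$, $f_{,2}:=\varepsilon(\delta_if)m^i$, and iterated symbols are read left to right, e.g. $f_{;2;2}=(f_{;2})_{;2}$, $f_{,1;2}=(f_{,1})_{;2}$. *)

(* Defs.v *)
From HB Require Import structures.
From mathcomp Require Import all_boot all_order all_algebra.
From mathcomp Require Import all_classical all_reals all_analysis.
Set Implicit Arguments.
Unset Strict Implicit.
Unset Printing Implicit Defensive.
Import Order.TTheory GRing.Theory Num.Theory.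
Import numFieldNormedType.Exports.
Local Open Scope classical_set_scope.
Local Open Scope ring_scope.

(* C^infinity on an open set A: every iterated directional derivative of f is
   Frechet differentiable at every point of A. *)
Definition smooth_on (R : realType) (V W : normedModType R) (A : set V)
    (f : V -> W) : Prop :=
  forall (vs : seq V) (x : V), A x ->
    differentiable (foldr (fun v (g : V -> W) => fun y => 'D_v g y) f vs) x.

Record surface (R : realType) (M : topologicalType) := Surface {
  surf_hausdorff : hausdorff_space M;
  surf_second_countable : @second_countable M;
  cidx : Type;
  cdom : cidx -> set M;
  chart : cidx -> M -> 'rV[R]_2;
  (* inverse of [chart a] on [chart a @` cdom a]; junk elsewhere *)
  param : cidx -> 'rV[R]_2 -> M;
  cdom_cover : forall p, exists a, cdom a p;
  cdom_open : forall a, open (cdom a);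
  chart_open : forall a, open (chart a @` cdom a);
  chartK : forall a p, cdom a p -> param a (chart a p) = p;
  chart_continuous : forall a, {within cdom a, continuous (chart a)};
  param_continuous : forall a,
    {within chart a @` cdom a, continuous (param a)};
  transition_smooth : forall a b,
    smooth_on (chart a @` (cdom a `&` cdom b)) (chart b \o param a)
}.

(* A tangent vector at [tbase] is its family of components in all the charts
   around [tbase], related by the Jacobians of the transition maps. The
   normalization [tcomp_out] makes equality of tangent vectors the intended
   one, since components in charts not containing [tbase] are meaningless. *)
Record tangent (R : realType) (M : topologicalType) (S : surface R M) :=
  Tangent {
  tbase : M;
  tcomp : cidx S -> 'rV[R]_2;
  tcomp_compat : forall a b, cdom a tbase -> cdom b tbase ->
    tcomp b = 'd (chart b \o param a) (chart a tbase) (tcomp a);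
  tcomp_out : forall a, ~ cdom a tbase -> tcomp a = 0
}.

Section TangentBundle.
Context (R : realType) (M : topologicalType) (S : surface R M).
Implicit Types (a : cidx S) (v : tangent S) (A : set (tangent S)).

Lemma tscale_compat (t : R) v a b : cdom a (tbase v) -> cdom b (tbase v) ->
  t *: tcomp v b =
  'd (chart b \o param a) (chart a (tbase v)) (t *: tcomp v a).
Proof. by move=> ha hb; rewrite linearZ /= -tcomp_compat. Qed.

Lemma tscale_out (t : R) v a : ~ cdom a (tbase v) -> t *: tcomp v a = 0.
Proof. by move=> ha; rewrite tcomp_out // scaler0. Qed.

Definition tscale (t : R) v : tangent S :=
  Tangent (@tscale_compat t v) (@tscale_out t v).

(* The induced coordinates (x, y) on TM. *)
Definition tcoord a v : 'rV[R]_2 * 'rV[R]_2 := (chart a (tbase v), tcomp v a).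

Definition coord_set a A : set ('rV[R]_2 * 'rV[R]_2) :=
  tcoord a @` (A `&` [set v | cdom a (tbase v)]).

(* The expression of f in the chart a; by [coord_funE] it is f read through
   the (injective) coordinates, and it is 0 outside their range. *)
Definition coord_fun a (f : tangent S -> R) (z : 'rV[R]_2 * 'rV[R]_2) : R :=
  xget 0 [set r | exists v, [/\ cdom a (tbase v), tcoord a v = z & r = f v]].

Lemma tcoord_inj a v w : cdom a (tbase v) -> cdom a (tbase w) ->
  tcoord a v = tcoord a w -> v = w.
Proof.
move=> av aw; rewrite /tcoord => -[ebase ecomp].
have eb : tbase v = tbase w by rewrite -(chartK av) ebase chartK.
have ec : tcomp v = tcomp w.
  apply: funext => b; have [bv|nbv] := pselect (cdom b (tbase v)).
    have bw : cdom b (tbase w) by rewrite -eb.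
    by rewrite (tcomp_compat av bv) (tcomp_compat aw bw) eb ecomp.
  by rewrite !tcomp_out // -eb.
clear -eb ec; case: v w eb ec => [p c h1 h2] [q d k1 k2] /= eb ec.
subst q d; congr Tangent; exact: Prop_irrelevance.
Qed.

Lemma coord_funE a f v : cdom a (tbase v) -> coord_fun a f (tcoord a v) = f v.
Proof.
move=> av; rewrite /coord_fun; case: xgetP => [r _ [w [aw /tcoord_inj -> //]]|].
by move=> /(_ (f v))[]; exists v.
Qed.

(* Openness for the manifold topology of TM, and smoothness of f on an open
   subset of TM, both read in the induced charts. *)
Definition open_TM A : Prop := forall a, open (coord_set a A).

Definition smooth_TM A (f : tangent S -> R) : Prop :=
  forall a, smooth_on (coord_set a A) (coord_fun a f).

Definition homogeneous_TM A (r : nat) (f : tangent S -> R) : Prop :=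
  forall v (t : R), A v -> 0 < t -> f (tscale t v) = t ^+ r * f v.

Definition nonzero_tangent v : Prop := exists a, tcomp v a != 0.

Record conic_subbundle A : Prop := ConicSubbundle {
  conic_nonempty : A !=set0;
  conic_open : open_TM A;
  conic_nonzero : forall v, A v -> nonzero_tangent v;
  conic_onto : forall p, exists2 v, A v & tbase v = p;
  conic_scale : forall v (t : R), A v -> 0 < t -> A (tscale t v)
}.

End TangentBundle.

(* Coordinate calculus: z = (x, y), and the index i in {1, 2} is i : 'I_2. *)
Section Coordinates.
Context (R : realType).
Local Notation point := ('rV[R]_2 * 'rV[R]_2)%type.
Implicit Types (F f : point -> R) (i j k : 'I_2) (z : point).

Definition dx i f : point -> R :=
  fun z => 'D_((delta_mx 0 i, 0) : 'rV[R]_2 * 'rV[R]_2) f z.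
Definition dy i f : point -> R :=
  fun z => 'D_((0, delta_mx 0 i) : 'rV[R]_2 * 'rV[R]_2) f z.
Definition ycoord i z : R := z.2 0 i.

Definition gmx F z : 'M[R]_2 :=
  \matrix_(i, j) (2^-1 * dy i (dy j (fun w => F w ^+ 2)) z).
Definition ginv F z : 'M[R]_2 := invmx (gmx F z).

Definition eps F z : R := Num.sg (\det (gmx F z)).
Definition ell_up F i z : R := ycoord i z / F z.

Definition m_low F i z : R :=
  let s := Num.sqrt (eps F z * \det (gmx F z)) in
  if i == 0 then - s * ell_up F 1 z else s * ell_up F 0 z.
Definition m_up F i z : R := \sum_j ginv F z i j * m_low F j z.

Definition cartan F i j k z : R := 2^-1 * dy k (fun w => gmx F w i j) z.

(* The scalar I determined by F C_ijk = I m_i m_j m_k. *)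
Definition main_scalar F z : R :=
  xget 0 [set I | forall i j k,
    F z * cartan F i j k z = I * m_low F i z * m_low F j z * m_low F k z].

Definition spray F i z : R :=
  4^-1 * \sum_j ginv F z i j *
    (\sum_k ycoord k z * dy j (dx k (fun w => F w ^+ 2)) z
     - dx j (fun w => F w ^+ 2) z).

Definition delta F i f : point -> R :=
  fun z => dx i f z - \sum_j dy i (spray F j) z * dy j f z.

(* f_{;2}, f_{,1} and f_{,2} *)
Definition sc2 F f : point -> R :=
  fun z => eps F z * F z * \sum_i dy i f z * m_up F i z.
Definition co1 F f : point -> R :=
  fun z => \sum_i delta F i f z * ell_up F i z.
Definition co2 F f : point -> R :=
  fun z => eps F z * \sum_i delta F i f z * m_up F i z.

Definition sigma F f z : R :=
  sc2 F (sc2 F f) z + eps F z * main_scalar F z * sc2 F f z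
  + 2 * sc2 F f z ^+ 2.

Definition rho F f z : R := (sigma F f z + eps F z - sc2 F f z ^+ 2)^-1.

Definition Qcoef F f z : R :=
  2^-1 * (eps F z * rho F f z * F z ^+ 2 *
    (sc2 F f z * co1 F f z + sc2 F (co1 F f) z - 2 * co2 F f z)).

End Coordinates.

Record conic_pseudo_finsler (R : realType) (M : topologicalType)
    (S : surface R M) (A : set (tangent S)) (F : tangent S -> R) : Prop :=
  ConicPseudoFinsler {
  cpf_subbundle : conic_subbundle A;
  cpf_smooth : smooth_TM A F;
  cpf_homogeneous : homogeneous_TM A 1 F;
  cpf_nondegenerate : forall (a : cidx S) z, coord_set a A z ->
    \det (gmx (coord_fun a F) z) != 0
}.

(* Main.v *)
(* Differentiating F d._i phi = phi_{;2} m_i along y shows that, in the Berwald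
   frame, e^(-2 phi) gbar_ij equals
     l_i l_j + phi_{;2} (l_i m_j + m_i l_j) + (sigma + eps) m_i m_j,
   whose determinant is a nonzero multiple of sigma + eps - phi_{;2}^2. The spray
   coefficients are the unique solution of the linear system
     4 gbar_ji Gbar^i = y^k d._j d_k Fbar^2 - d_j Fbar^2,
   and differentiating F phi_{,1} = y^k d_k phi - 2 G^l d._l phi along y turns
   its right-hand side into 4 gbar_ji G^i +
     2 e^(2 phi) F^2 (phi_{,1} l_j
       + (2 phi_{;2} phi_{,1} + phi_{,1;2} - 2 phi_{,2}) m_j).
   Solving for the l- and m-components of Gbar - G gives the formula. Since the
   manifold is two-dimensional, Euler's identities alone make d._i d._j F^2
   symmetric, so no theorem on mixed derivatives is needed. *)
Require Import Defs.
From HB Require Import structures.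
From mathcomp Require Import all_boot all_order all_algebra.
From mathcomp Require Import all_classical all_reals all_analysis.
From mathcomp Require Import ring lra.
Import Order.TTheory GRing.Theory Num.Theory.
Import numFieldNormedType.Exports.
Set Implicit Arguments.
Unset Strict Implicit.
Unset Printing Implicit Defensive.
Local Open Scope classical_set_scope.
Local Open Scope ring_scope.

(** * Calculus rules for directional derivatives *)

Section Gradients.
Context (R : realType) (V : normedModType R).
Implicit Types (f g : V -> R) (z v : V) (U : set V).

(** Pairing differentiability with the values of all directional derivatives lets each rule deliver
    both at once, so a composite expression is differentiated by nesting the rules. *)
Definition has_grad f z (d : V -> R) : Prop :=
  differentiable f z /\ forall v, 'D_v f z = d v.

Lemma has_grad_self f z :
  differentiable f z -> has_grad f z (fun v => 'D_v f z).
Proof. by []. Qed.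

Lemma has_grad_cst (c : R) z : has_grad (fun=> c) z (fun=> 0).
Proof. by split=> [|v]; [exact: differentiable_cst|exact: derive_cst]. Qed.

Lemma has_gradD f g z df dg : has_grad f z df -> has_grad g z dg ->
  has_grad (fun w => f w + g w) z (fun v => df v + dg v).
Proof.
move=> [f1 f2] [g1 g2]; split=> [|v]; first exact: differentiableD.
by rewrite -f2 -g2; apply: deriveD; apply: diff_derivable.
Qed.

Lemma has_gradN f z df : has_grad f z df ->
  has_grad (fun w => - f w) z (fun v => - df v).
Proof.
move=> [f1 f2]; split=> [|v]; first exact: differentiableN.
by rewrite -f2; apply: deriveN; apply: diff_derivable.
Qed.

Lemma has_gradB f g z df dg : has_grad f z df -> has_grad g z dg ->
  has_grad (fun w => f w - g w) z (fun v => df v - dg v).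
Proof. by move=> hf hg; apply: has_gradD hf (has_gradN hg). Qed.

Lemma has_gradM f g z df dg : has_grad f z df -> has_grad g z dg ->
  has_grad (fun w => f w * g w) z (fun v => df v * g z + f z * dg v).
Proof.
move=> [f1 f2] [g1 g2]; split=> [|v]; first exact: differentiableM.
have := deriveM (diff_derivable (v := v) f1) (diff_derivable (v := v) g1).
by rewrite f2 g2 addrC /GRing.scale /= [g z * _]mulrC => ->.
Qed.

Lemma has_gradX2 f z df : has_grad f z df ->
  has_grad (fun w => f w ^+ 2) z (fun v => 2 * f z * df v).
Proof.
move=> hf; have [d e] := has_gradM hf hf; split=> [//|v].
by rewrite e mulrC -mulrDl -mulr2n mulr_natl mulrC.
Qed.

Lemma has_gradV f z df : f z != 0 -> has_grad f z df ->
  has_grad (fun w => (f w)^-1) z (fun v => - df v / f z ^+ 2).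
Proof.
move=> f0 [f1 f2]; split=> [|v]; first exact: differentiableV.
rewrite -f2 deriveV //; last exact: diff_derivable.
by rewrite scaleNr mulNr mulrC.
Qed.

Lemma has_grad_comp f z df (h : R -> R) (h' : R) :
  is_derive (f z) 1 h h' -> has_grad f z df ->
  has_grad (fun w => h (f w)) z (fun v => df v * h').
Proof.
move=> hh [f1 f2].
have dh : differentiable h (f z) by apply/derivable1_diffP.
split=> [|v]; first exact: (differentiable_comp f1 dh).
rewrite deriveE; last exact: (differentiable_comp f1 dh).
rewrite (diff_comp f1 dh) /= -f2 (deriveE _ f1).
rewrite -[X in 'd h (f z) X]mulr1 [LHS]linearZ /=.
by rewrite -(deriveE _ dh) derive_val.
Qed.

Lemma has_grad_sqrt f z df : 0 < f z -> has_grad f z df ->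
  has_grad (fun w => Num.sqrt (f w)) z (fun v => df v / (2 * Num.sqrt (f z))).
Proof. by move=> f0; apply: has_grad_comp; exact: is_derive1_sqrt. Qed.

Lemma has_grad_expR f z df : has_grad f z df ->
  has_grad (fun w => expR (f w)) z (fun v => df v * expR (f z)).
Proof. by apply: has_grad_comp; exact: is_derive_expR. Qed.

(** Being differentiable and having given derivatives are local properties. This is what allows an
    identity known only on an open set to be differentiated there. *)
Lemma has_grad_eq_on U f g z d : open U -> U z ->
  (forall w, U w -> f w = g w) -> has_grad g z d -> has_grad f z d.
Proof.
move=> oU Uz fg [g1 g2].
have nfg : \near z, f z = g z.
  by have := open_nbhs_nbhs (conj oU Uz); apply: filterS.
have ngf : \near z, g z = f z by apply: filterS nfg.
split=> [|v]; last by rewrite -g2; exact: near_eq_derive.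
have [c e] := (diff_locallyP _ _).1 g1.
apply/diff_locallyP.
(* The first-order expansion of [g] at [z] also serves [f], and an expansion with continuous linear
   part determines the differential. *)
suff e' : f \o shift z = cst (f z) + 'd g z +o_ 0 id.
  by rewrite (diff_unique c e').
apply/eqaddoP => eps eps0.
move/eqaddoP: e => /(_ eps eps0).
have nfg0 : \forall h \near (0 : V), f (h + z) = g (h + z).
  by move: nfg; rewrite (near_shift 0) /= subr0.
apply: filterS2 nfg0 => h /= fgh.
by rewrite !fctE /= fgh (nbhs_singleton nfg).
Qed.
End Gradients.

Lemma sum_ord2 (V : nmodType) (f : 'I_2 -> V) : \sum_i f i = f 0 + f 1.
Proof.
rewrite !big_ord_recl big_ord0 addr0; congr (f _ + f _); exact: val_inj.
Qed.

Lemma ord2P (P : 'I_2 -> Prop) : P 0 -> P 1 -> forall i, P i.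
Proof.
move=> P0 P1 [[|[|//]] h]; first by rewrite (_ : Ordinal h = 0) //; apply: val_inj.
by rewrite (_ : Ordinal h = 1) //; apply: val_inj.
Qed.

(** * Dilations in $y$ and Euler's identity *)

Section Homogeneity.
Context (R : realType).
Local Notation point := ('rV[R]_2 * 'rV[R]_2)%type.
Implicit Types (f : point -> R) (z v : point) (U : set point).

Definition yscale (t : R) z : point := (z.1, t *: z.2).

Definition homogeneous_on U (r : nat) f : Prop :=
  forall z (t : R), U z -> 0 < t -> f (yscale t z) = t ^+ r * f z.

Definition yconic U : Prop :=
  forall z (t : R), U z -> 0 < t -> U (yscale t z).

Lemma derive_line f z v :
  'D_v f z = 'D_1 (fun h : R => f (h *: v + z)) 0.
Proof.
rewrite /derive; set g1 := fun h => h^-1 *: _; set g2 := fun h => h^-1 *: _.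
suff -> : g1 = g2 by [].
by apply: funext => h; rewrite /g1 /g2 /= addr0 scale0r add0r [_%:A]mulr1.
Qed.

Lemma near_line U z v : open U -> U z ->
  \forall h \near (0 : R), U (h *: v + z).
Proof.
move=> oU Uz.
have c : {for 0, continuous (fun h : R => h *: v + z)}.
  by apply: cvgD; [apply: cvgZr_tmp; exact: cvg_id|exact: cvg_cst].
apply: c; rewrite /= scale0r add0r; exact: open_nbhs_nbhs.
Qed.

(** The dilation is linear, so it maps the line through [z] in direction [v] to the line through the
    dilated point in the dilated direction. Near $h=0$ the function on the second line is [c] times
    the function on the first. *)
Lemma derive_yscale U f (c t : R) z v : open U -> U z ->
    (forall w, U w -> f (yscale t w) = c * f w) -> differentiable f z ->
  'D_(yscale t v) f (yscale t z) = c * 'D_v f z.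
Proof.
move=> oU Uz ft df; rewrite !derive_line.
have -> : (fun h : R => f (h *: yscale t v + yscale t z)) =
          (fun h => f (yscale t (h *: v + z))).
  apply: funext => h; congr f; rewrite /yscale /=; congr pair.
  by rewrite /= scalerDr !scalerA mulrC.
rewrite (@near_eq_derive R R R _ (fun h => c * f (h *: v + z))); last first.
  have nU := near_line v oU Uz. by apply: filterS nU => h Uh; exact: ft.
have := @deriveMl R R (fun h : R => f (h *: v + z)) c 0 1.
by apply; exact: (derivable1P f z v).1 (diff_derivable df).
Qed.

Lemma derive_lin f z (a b : R) v w : differentiable f z ->
  'D_(a *: v + b *: w) f z = a * 'D_v f z + b * 'D_w f z.
Proof. by move=> df; rewrite !deriveE // linearD !linearZ. Qed.

Lemma derive_y f z (y : 'rV[R]_2) : differentiable f z ->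
  'D_((0, y) : point) f z = \sum_i y 0 i * dy i f z.
Proof.
move=> df; rewrite sum_ord2 -derive_lin //; congr ('D_ _ f z).
rewrite {1}[y]row_sum_delta sum_ord2; congr pair.
by rewrite /= !scaler0 addr0.
Qed.

Lemma euler U r f z : open U -> U z -> differentiable f z ->
  homogeneous_on U r f -> \sum_i ycoord i z * dy i f z = r%:R * f z.
Proof.
move=> oU Uz df hf; rewrite -derive_y // derive_line.
(* Moving from $(x,y)$ by $h(0,y)$ is the dilation by $1+h$, which is positive for $|h|<1$; the
   derivative of $(1+h)^r$ at $0$ is $r$. *)
rewrite (@near_eq_derive R R R _ (fun h : R => (1 + h) ^+ r * f z)).
  have d1 : is_derive (0 : R) 1 (fun h => 1 + h) 1.
    have -> : (fun h : R => 1 + h) = cst 1 + id by [].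
    by apply: is_derive_eq; rewrite add0r.
  have E : (fun h : R => (1 + h) ^+ r) = (fun h => 1 + h) ^+ r.
    by apply: funext => h; rewrite exprfctE.
  have [e1 e2] := @is_deriveX R R _ r 0 1 1 d1.
  rewrite -E in e1 e2.
  have := deriveMr (f z) e1; rewrite e2 addr0 expr1n mulr1 [_ *: _]mulr1.
  by rewrite mulrC => ->.
have n0 : \forall h \near (0 : R), 0 < 1 + h.
  exists 1 => [|h] /=; first exact: ltr01.
  rewrite distrC subr0 ltr_norml => /andP[h1 _].
  by rewrite -ltrBlDl sub0r.
apply: filterS n0 => h h0.
rewrite -hf //; congr f; rewrite /yscale; case: z {Uz df} => x y /=.
by congr pair; rewrite /= ?scaler0 ?add0r // scalerDl scale1r addrC.
Qed.

(** The direction has no $y$-component, hence is fixed by the dilation, and the degree is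
    preserved. *)
Lemma homogeneous_dx U r f i : open U ->
  (forall z, U z -> differentiable f z) ->
  homogeneous_on U r f -> homogeneous_on U r (dx i f).
Proof.
move=> oU df hf z t Uz t0.
have := derive_yscale (delta_mx 0 i, 0) oU Uz
  (fun w Uw => hf w t Uw t0) (df z Uz).
by rewrite /yscale /= scaler0.
Qed.

(** The dilation multiplies a vertical direction by [t], which lowers the degree by one. Leaving [t]
    on the left covers [r = 0], where the derivative has degree $-1$. *)
Lemma dy_yscale U r f i z (t : R) : open U -> yconic U ->
  (forall z, U z -> differentiable f z) ->
  homogeneous_on U r f -> U z -> 0 < t ->
  t * dy i f (yscale t z) = t ^+ r * dy i f z.
Proof.
move=> oU cU df hf Uz t0; rewrite /dy -(@derive_yscale U f (t ^+ r) t) //.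
- have -> : yscale t (0, delta_mx 0 i) = t *: (0, delta_mx 0 i) + 0 *: 0.
    by rewrite scaler0 addr0; congr pair; rewrite /= scaler0.
  by rewrite derive_lin ?mul0r ?addr0 //; apply: df; apply: cU.
- by move=> w Uw; exact: hf.
- exact: df.
Qed.

Lemma homogeneous_dy U r f i : open U -> yconic U ->
  (forall z, U z -> differentiable f z) ->
  homogeneous_on U r.+1 f -> homogeneous_on U r (dy i f).
Proof.
move=> oU cU df hf z t Uz t0; apply: (mulfI (lt0r_neq0 t0)).
by rewrite mulrA -exprS; apply: dy_yscale hf _ _.
Qed.

End Homogeneity.

(** The square root occurring in [m_low], that is, the area density $\sqrt{|\det g|}$. *)
Definition vol (R : realType) (F : 'rV[R]_2 * 'rV[R]_2 -> R)
    (z : 'rV[R]_2 * 'rV[R]_2) : R :=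
  Num.sqrt (eps F z * \det (gmx F z)).

(* [ring], [field] and [lra] compare atoms up to conversion, which is very
   slow on derivatives; replacing these by variables avoids it. *)
Ltac derivative_atoms :=
  repeat match goal with
  | |- context ['D_?v ?f ?z] => generalize ('D_v f z); intro
  end.

Ltac atoms F z :=
  repeat match goal with
  | |- context [dy ?i ?f z] => generalize (dy i f z); intro
  | |- context [dx ?i ?f z] => generalize (dx i f z); intro
  | |- context [ycoord ?i z] => generalize (ycoord i z); intro
  | |- context [gmx F z ?i ?j] => generalize (gmx F z i j); intro
  | |- context [m_low F ?i z] => generalize (m_low F i z); intro
  | |- context ['D_?v ?f z] => generalize ('D_v f z); intro
  | |- context [determinant (gmx F z)] => generalize (determinant (gmx F z)); intro
  | |- context [eps F z] => generalize (eps F z); intro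
  | |- context [vol F z] => generalize (vol F z); intro
  | |- context [F z] => generalize (F z); intro
  end.

(* The two contractions of a 2x2 matrix with [y] determine its antisymmetric
   part up to a multiple of [y], so no equality of mixed derivatives is needed. *)
Section Coordinates.
Context (R : realType).
Local Notation point := ('rV[R]_2 * 'rV[R]_2)%type.
Implicit Types (f : point -> R) (z v : point) (i : 'I_2).

(** * Vertical derivatives, and the $2\times2$ linear system of the spray *)

Lemma has_grad_dy f z d i : has_grad f z d ->
  dy i f z = d ((0, delta_mx 0 i) : point).
Proof. by move=> [_ E]; exact: E. Qed.

Lemma dyE f z i : 'D_((0, delta_mx 0 i) : point) f z = dy i f z.
Proof. by []. Qed.

Lemma has_grad_sum2 (f : 'I_2 -> point -> R) z (d : 'I_2 -> point -> R) :
  (forall i, has_grad (f i) z (d i)) ->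
  has_grad (fun w => \sum_i f i w) z (fun v => \sum_i d i v).
Proof.
move=> h.
have -> : (fun w => \sum_i f i w) = (fun w => f 0 w + f 1 w).
  by apply: funext => w; rewrite sum_ord2.
have -> : (fun v => \sum_i d i v) = (fun v => d 0 v + d 1 v).
  by apply: funext => w; rewrite sum_ord2.
exact: has_gradD.
Qed.

Lemma has_grad_ycoord (k : 'I_2) z : has_grad (ycoord (R:=R) k) z (fun v => v.2 0 k).
Proof.
split=> [|v].
  have lin : linear (ycoord k : point -> R).
    by move=> a u w; rewrite /ycoord /= !mxE.
  pose linM := GRing.isLinear.Build _ _ _ _ _ lin.
  pose L : {linear point -> R} := HB.pack (ycoord k : point -> R) linM.
  apply: (@linear_differentiable _ _ _ L) => w.
  exact: (continuous_comp (@cvg_snd _ _ _ _ _) (@coord_continuous R 1 2 0 k _)).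
rewrite derive_line.
have -> : (fun h : R => ycoord k (h *: v + z)) =
          (v.2 0 k \*: id) + cst (z.2 0 k).
  by apply: funext => h; rewrite /ycoord !fctE /= !mxE mulrC.
by rewrite derive_val addr0 [_ *: _]mulr1.
Qed.

(** The free term comes from $\dot\partial_j y^k=\delta^k_j$. Euler-type identities are
    differentiated along $y$ in this form. *)
Lemma dy_ycontract (f : 'I_2 -> point -> R) j z :
    (forall k, differentiable (f k) z) ->
  dy j (fun w => \sum_k ycoord k w * f k w) z =
  f j z + \sum_k ycoord k z * dy j (f k) z.
Proof.
move=> df.
have H k := has_gradM (has_grad_ycoord k z) (has_grad_self (df k)).
have [_ E] := has_grad_sum2 H.
rewrite /dy E !sum_ord2 /= !mxE /=.
by elim/ord2P: j => /=; ring.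
Qed.

Lemma det_mx2 (A : 'M[R]_2) : \det A = A 0 0 * A 1 1 - A 0 1 * A 1 0.
Proof.
rewrite (expand_det_row _ 0) sum_ord2 /cofactor !det_mx11 !mxE /=.
rewrite (_ : lift 0 0 = 1) //; last exact: val_inj.
rewrite (_ : lift 1 0 = 0) //; last exact: val_inj.
by rewrite expr0 expr1; ring.
Qed.

Lemma invmx_mulE (A : 'M[R]_2) (X b : 'I_2 -> R) : \det A != 0 ->
  (forall i : 'I_2, \sum_j A i j * X j = b i) ->
  forall i, \sum_j invmx A i j * b j = X i.
Proof.
move=> dA AX i.
have uA : A \in unitmx by rewrite unitmxE unitfE.
have -> : X i = (invmx A *m (A *m \col_j X j)) i 0.
  by rewrite mulKmx // mxE.
rewrite mxE; apply: eq_bigr => j _; congr (_ * _).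
by rewrite -AX mxE; apply: eq_bigr => k _; rewrite mxE.
Qed.

Lemma invmx_mul_lin (A : 'M[R]_2) (b : 'I_2 -> R) i : \det A != 0 ->
  \sum_j A i j * (\sum_k invmx A j k * b k) = b i.
Proof.
move=> dA.
have uA : A \in unitmx by rewrite unitmxE unitfE.
transitivity ((A *m (invmx A *m \col_j b j)) i 0).
  rewrite mxE; apply: eq_bigr => j _; congr (_ * _).
  by rewrite mxE; apply: eq_bigr => k _; rewrite mxE.
by rewrite mulKVmx // mxE.
Qed.

Lemma gmxE (F : point -> R) i (j : 'I_2) z :
  gmx F z i j = 2^-1 * dy i (dy j (fun w => F w ^+ 2)) z.
Proof. by rewrite mxE. Qed.

(** The covector whose index is raised in [spray], so that $4g_{ij}G^j$ equals it. *)
Definition spray_rhs (F : point -> R) j z : R :=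
  \sum_k ycoord k z * dy j (dx k (fun w => F w ^+ 2)) z
  - dx j (fun w => F w ^+ 2) z.

Lemma spray_system (F : point -> R) z i : \det (gmx F z) != 0 ->
  \sum_j gmx F z i j * spray F j z = 4^-1 * spray_rhs F i z.
Proof.
move=> dF; rewrite -(invmx_mul_lin (fun j => 4^-1 * spray_rhs F j z) i dF).
apply: eq_bigr => j _; congr (_ * _); rewrite /spray mulr_sumr.
by apply: eq_bigr => k _; rewrite mulrCA.
Qed.

(** Spray coefficients are identified by checking a candidate in the linear system, without
    computing the inverse metric. *)
Lemma spray_unique (F : point -> R) z (X : 'I_2 -> R) :
  \det (gmx F z) != 0 ->
  (forall i, \sum_j gmx F z i j * X j = 4^-1 * spray_rhs F i z) ->
  forall i, spray F i z = X i.
Proof.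
move=> dF h i; rewrite -(invmx_mulE dF h) /spray mulr_sumr.
by apply: eq_bigr => k _; rewrite mulrCA.
Qed.

End Coordinates.

(** * Derivatives of $F^2$ in terms of those of $F$ *)

Section Sqr.
Context (R : realType) (V : normedModType R) (U : set V) (F : V -> R).
Hypotheses (oU : open U) (sF : smooth_on U F).
Let P w := F w ^+ 2.

Lemma smooth_diff0 z : U z -> differentiable F z.
Proof. exact: (sF [::]). Qed.

Lemma smooth_diff1 u z : U z -> differentiable (fun w => 'D_u F w) z.
Proof. exact: (sF [:: u]). Qed.

Lemma smooth_diff2 u v z : U z ->
  differentiable (fun w => 'D_v (fun w => 'D_u F w) w) z.
Proof. exact: (sF [:: v; u]). Qed.

Lemma derive_sqr u z : U z -> 'D_u P z = 2 * F z * 'D_u F z.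
Proof.
by move=> Uz; have [_ ->] := has_gradX2 (has_grad_self (smooth_diff0 Uz)).
Qed.

Lemma diff_sqr z : U z -> differentiable P z.
Proof. by move=> Uz; have [] := has_gradX2 (has_grad_self (smooth_diff0 Uz)). Qed.

Let G u z (Uz : U z) :=
  has_gradM (has_gradM (has_grad_cst 2 z) (has_grad_self (smooth_diff0 Uz)))
    (has_grad_self (smooth_diff1 u Uz)).

Lemma diff_derive_sqr u z : U z -> differentiable (fun w => 'D_u P w) z.
Proof.
by move=> Uz; have [] := has_grad_eq_on oU Uz (derive_sqr u) (G u Uz).
Qed.

Lemma derive_derive_sqr u v z : U z ->
  'D_v (fun w => 'D_u P w) z =
  2 * ('D_v F z * 'D_u F z) + 2 * (F z * 'D_v (fun w => 'D_u F w) z).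
Proof.
move=> Uz; have [_ ->] := has_grad_eq_on oU Uz (derive_sqr u) (G u Uz).
by move: (F z) => f; derivative_atoms; ring.
Qed.

(** This order of differentiability is what the $y$-derivatives of $g_{ij}$ and of the spray call
    for. *)
Lemma diff_derive_derive_sqr u v z : U z ->
  differentiable (fun w => 'D_v (fun w => 'D_u P w) w) z.
Proof.
move=> Uz; have D1 t := has_grad_self (smooth_diff1 t Uz).
have c2 := has_grad_cst 2 z.
have D := has_gradD (has_gradM c2 (has_gradM (D1 v) (D1 u)))
  (has_gradM c2 (has_gradM (has_grad_self (smooth_diff0 Uz))
    (has_grad_self (smooth_diff2 u v Uz)))).
by have [] := has_grad_eq_on oU Uz (derive_derive_sqr u v) D.
Qed.

End Sqr.

(** * Derivatives of $\overline F^2=e^{2\phi}F^2$ *)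

Section ConformalSqr.
Context (R : realType) (V : normedModType R) (U : set V) (F phi Fb : V -> R).
Hypotheses (oU : open U) (sF : smooth_on U F) (sphi : smooth_on U phi)
  (FbE : forall w, U w -> Fb w = expR (phi w) * F w).
Local Notation P := (fun w => F w ^+ 2).
Local Notation Pb := (fun w => Fb w ^+ 2).

Let Dphi u z (Uz : U z) := has_grad_self (smooth_diff1 sphi u Uz).
Let DP u z (Uz : U z) := has_grad_self (diff_derive_sqr oU sF u Uz).

Let De z (Uz : U z) : has_grad (fun w => expR (phi w) ^+ 2) z
  (fun v => 2 * expR (phi z) * ('D_v phi z * expR (phi z))) :=
  has_gradX2 (has_grad_expR (has_grad_self (smooth_diff0 sphi Uz))).

Lemma conformal_sqr w : U w -> Pb w = expR (phi w) ^+ 2 * P w.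
Proof. by move=> Uw; rewrite /= FbE // exprMn. Qed.

Lemma derive_conformal_sqr u z : U z ->
  'D_u Pb z = expR (phi z) ^+ 2 * (2 * 'D_u phi z * F z ^+ 2 + 'D_u P z).
Proof.
move=> Uz.
have D := has_gradM (De Uz) (has_grad_self (diff_sqr sF Uz)).
have [_ ->] := has_grad_eq_on oU Uz conformal_sqr D.
by move: (expR _) (F z) ('D_u P z) ('D_u phi z) => e f a b; ring.
Qed.

Lemma derive_derive_conformal_sqr u v z : U z ->
  'D_v (fun w => 'D_u Pb w) z = expR (phi z) ^+ 2 *
    (2 * 'D_v phi z * (2 * 'D_u phi z * F z ^+ 2 + 'D_u P z)
     + 2 * 'D_v (fun w => 'D_u phi w) z * F z ^+ 2
     + 2 * 'D_u phi z * 'D_v P z + 'D_v (fun w => 'D_u P w) z).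
Proof.
move=> Uz.
have D := has_gradM (De Uz) (has_gradD
  (has_gradM (has_gradM (has_grad_cst 2 z) (Dphi u Uz))
    (has_grad_self (diff_sqr sF Uz))) (DP u Uz)).
have [_ ->] := has_grad_eq_on oU Uz (derive_conformal_sqr u) D.
move: (expR _) (F z) ('D_u P z) ('D_v P z) ('D_v (fun w => 'D_u P w) z) => e f a b d.
by derivative_atoms; ring.
Qed.

End ConformalSqr.

Section ConformalSqrCoordinates.
Context (R : realType).
Local Notation point := ('rV[R]_2 * 'rV[R]_2)%type.
Variables (U : set point) (F phi Fb : point -> R).
Hypotheses (oU : open U) (sF : smooth_on U F) (sphi : smooth_on U phi)
  (FbE : forall w, U w -> Fb w = expR (phi w) * F w).
Local Notation P := (fun w => F w ^+ 2).
Local Notation Pb := (fun w => Fb w ^+ 2).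
Implicit Types (z : point) (i j : 'I_2).

Lemma dx_conformal_sqr i z : U z ->
  dx i Pb z = expR (phi z) ^+ 2 * (2 * dx i phi z * F z ^+ 2 + dx i P z).
Proof. exact: derive_conformal_sqr. Qed.

Lemma dy_dy_conformal_sqr i j z : U z ->
  dy j (dy i Pb) z = expR (phi z) ^+ 2 *
    (2 * dy j phi z * (2 * dy i phi z * F z ^+ 2 + dy i P z)
     + 2 * dy j (dy i phi) z * F z ^+ 2
     + 2 * dy i phi z * dy j P z + dy j (dy i P) z).
Proof. exact: derive_derive_conformal_sqr. Qed.

Lemma dy_dx_conformal_sqr i j z : U z ->
  dy j (dx i Pb) z = expR (phi z) ^+ 2 *
    (2 * dy j phi z * (2 * dx i phi z * F z ^+ 2 + dx i P z)
     + 2 * dy j (dx i phi) z * F z ^+ 2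
     + 2 * dx i phi z * dy j P z + dy j (dx i P) z).
Proof. exact: derive_derive_conformal_sqr. Qed.

End ConformalSqrCoordinates.

(** * Identities between scalars at a point *)

(** Comparing row and column contractions gives $(a_{01}-a_{10})y_i=0$ for both $i$; pairing with
    $l$ replaces $y$ by $f\neq0$. *)
Lemma sym_of_contractions (K : fieldType) (a00 a01 a10 a11 y0 y1 l0 l1 f : K) :
  a00 * y0 + a10 * y1 = f * l0 -> a01 * y0 + a11 * y1 = f * l1 ->
  a00 * y0 + a01 * y1 = f * l0 -> a10 * y0 + a11 * y1 = f * l1 ->
  f != 0 -> y0 * l0 + y1 * l1 = f -> a01 = a10.
Proof.
move=> h0 h1 k0 k1 f0 e; apply/eqP; rewrite -subr_eq0; apply/eqP.
apply: (mulIf f0); rewrite mul0r -e.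
transitivity (((a01 * y0 + a11 * y1) - (a10 * y0 + a11 * y1)) * l0
  + ((a00 * y0 + a01 * y1) - (a00 * y0 + a10 * y1)) * l1); first by ring.
by rewrite h0 h1 k0 k1 !subrr !mul0r addr0.
Qed.

Lemma half_mul_div (K : numFieldType) (a b c : K) : c ^+ 2 = 1 -> b != 0 ->
  c != 0 -> 2 * b * a / (2 * (c * b)) = c * a.
Proof.
move=> c2 b0 c0; transitivity (c^-1 * a); first by field; rewrite b0 c0.
by congr (_ * _); apply: (mulfI c0); rewrite mulfV // -c2 expr2.
Qed.

(** Multiplied by $f^2=g_{ij}y^iy^j$, each entry becomes the polynomial identity
    $f^2g_{ij}=(gy)_i(gy)_j+\det(g)\,n_in_j$ with $n=(-y_1,y_0)$. *)
Lemma metric_frame (K : fieldType) (g00 g01 g10 g11 y0 y1 l0 l1 f : K) :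
  g00 * y0 + g01 * y1 = f * l0 -> g10 * y0 + g11 * y1 = f * l1 ->
  y0 * l0 + y1 * l1 = f -> g01 = g10 -> forall s e : K,
  e * s ^+ 2 = g00 * g11 - g10 ^+ 2 -> f != 0 ->
  let m0 := - s * y1 / f in let m1 := s * y0 / f in
  [/\ g00 = l0 * l0 + e * m0 * m0, g10 = l0 * l1 + e * m0 * m1,
      g10 = l1 * l0 + e * m1 * m0 & g11 = l1 * l1 + e * m1 * m1].
Proof.
move=> k0 k1 ef e01 s e es f0 m0 m1; rewrite e01 in k0.
have f2 : f ^+ 2 = g00 * y0 ^+ 2 + 2 * g10 * y0 * y1 + g11 * y1 ^+ 2.
  transitivity ((f * l0) * y0 + (f * l1) * y1); first by rewrite expr2 -{1}ef; ring.
  by rewrite -k0 -k1; ring.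
have key (a b c p q : K) : f ^+ 2 * c = (f * a) * (f * b) + (e * s ^+ 2) * (p * q) ->
    c = a * b + e * (s * p / f) * (s * q / f).
  by move=> h; apply: (mulfI (expf_neq0 2 f0)); rewrite h; field.
have n0 : m0 = s * (- y1) / f by rewrite /m0 mulrN mulNr.
rewrite n0; split; apply: key; rewrite f2 es -?k0 -?k1; ring.
Qed.

Lemma frame_dual (K : fieldType) (l0 l1 l m0 m1 m e s : K) :
  e ^+ 2 = 1 -> s != 0 -> l0 * m1 - l1 * m0 = s ->
  (l * l0 + e * m * m0) * (- e * l1 / s) + (l * l1 + e * m * m1) * (e * l0 / s) = m.
Proof.
move=> e2 s0 w.
transitivity (e ^+ 2 * m * (l0 * m1 - l1 * m0) / s); first by field.
by rewrite e2 w mul1r mulfK.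
Qed.

Lemma covector_frame_expand (K : fieldType) (w0 w1 y0 y1 l0 l1 f e s : K) :
  e ^+ 2 = 1 -> s != 0 -> f != 0 -> y0 * l0 + y1 * l1 = f ->
  let a := w0 * (y0 / f) + w1 * (y1 / f) in
  let b := w0 * (- e * l1 / s) + w1 * (e * l0 / s) in
  w0 = a * l0 + e * b * (- s * y1 / f) /\ w1 = a * l1 + e * b * (s * y0 / f).
Proof.
move=> e2 s0 f0 ef a b; split.
  transitivity ((w0 * (y0 * l0) + w1 * (y1 * l0)
    - e ^+ 2 * (w1 * l0 - w0 * l1) * y1) / f).
    rewrite e2 mul1r; apply: (mulIf f0); rewrite mulfVK // -{1}ef; ring.
  by rewrite /a /b; field; rewrite s0 f0.
transitivity ((w0 * (y0 * l1) + w1 * (y1 * l1)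
    + e ^+ 2 * (w1 * l0 - w0 * l1) * y0) / f).
  rewrite e2 mul1r; apply: (mulIf f0); rewrite mulfVK // -{1}ef; ring.
by rewrite /a /b; field; rewrite s0 f0.
Qed.

Lemma sc2_scalar (K : fieldType) (a0 a1 l0 l1 f e s : K) : e ^+ 2 = 1 ->
  e * f * (a0 * (- e * l1 / s) + a1 * (e * l0 / s))
  = f * (a1 * l0 - a0 * l1) / s.
Proof.
move=> e2; transitivity (e ^+ 2 * (f * (a1 * l0 - a0 * l1) / s)); first by ring.
by rewrite e2 mul1r.
Qed.

Lemma half_div_eq (K : numFieldType) (I f d a b c : K) : f != 0 ->
  f * (2^-1 * d) = I * a * b * c -> f * d = f * (2 * I * a * b * c / f).
Proof.
move=> f0 h; transitivity (2 * (f * (2^-1 * d))); first by field.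
by rewrite h; field.
Qed.

(** [dd] is the derivative of $\det g$ by the product rule, with the derivative of $g_{ij}$
    proportional to $m_im_j$. The quartic terms in $m$ cancel and the square of $l_0m_1-l_1m_0=s$
    remains. *)
Lemma dy_vol_scalar (K : numFieldType) (I f s e l0 l1 m0 m1 m ds dd : K) :
  f != 0 -> s != 0 -> l0 * m1 - l1 * m0 = s -> ds = e * dd / (2 * s) ->
  dd = 2 * I * m0 * m0 * m / f * (l1 * l1 + e * m1 * m1)
    + (l0 * l0 + e * m0 * m0) * (2 * I * m1 * m1 * m / f)
    - (2 * I * m0 * m1 * m / f * (l1 * l0 + e * m1 * m0)
       + (l0 * l1 + e * m0 * m1) * (2 * I * m1 * m0 * m / f)) ->
  f * ds = e * I * m * s.
Proof.
move=> f0 s0 w -> ->.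
transitivity (e * I * m * (l0 * m1 - l1 * m0) ^+ 2 / s).
  by field; rewrite s0 f0.
by rewrite w; field.
Qed.

Lemma contraction_sum (K : fieldType) (g00 g01 g11 y0 y1 l0 l1 f a b : K) :
  g00 * y0 + g01 * y1 = f * l0 -> g01 * y0 + g11 * y1 = f * l1 ->
  y0 * (g00 * a + g01 * b) + y1 * (g01 * a + g11 * b) = f * (l0 * a + l1 * b).
Proof.
move=> h0 h1; transitivity ((f * l0) * a + (f * l1) * b); last by ring.
by rewrite -h0 -h1; ring.
Qed.

(** Here [t] stands for the Kronecker delta $\dot\partial_jy$; the hypothesis on it is the wedge
    identity $l_0m_1-l_1m_0=s$, or $0=0$ when the delta vanishes. *)
Lemma dy_m_low_scalar0 (K : fieldType) (f e I s dv y li lj mi mj t : K) :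
  f != 0 -> mi = - s * y / f -> - s * t = lj * mi - li * mj ->
  f * dv = e * I * mj * s ->
  f * ((- dv * y + - s * t) / f + - s * y * (- lj / f ^+ 2)) =
  (e * I * mi - li) * mj.
Proof.
move=> f0 m st h; rewrite st.
transitivity (- (f * dv) * y / f + (lj * mi - li * mj) - lj * (- s * y / f)).
  by field.
by rewrite h -m; rewrite m; field.
Qed.

Lemma dy_m_low_scalar1 (K : fieldType) (f e I s dv y li lj mi mj t : K) :
  f != 0 -> mi = s * y / f -> s * t = lj * mi - li * mj ->
  f * dv = e * I * mj * s ->
  f * ((dv * y + s * t) / f + s * y * (- lj / f ^+ 2)) = (e * I * mi - li) * mj.
Proof.
move=> f0 m st h; rewrite st.
transitivity ((f * dv) * y / f + (lj * mi - li * mj) - lj * (s * y / f)).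
  by field.
by rewrite h -m; rewrite m; field.
Qed.

Lemma dy_dy_phi_scalar (K : fieldType)
    (f fj pi pji qj mi dm q2 q e I mj li : K) :
  f * qj = q2 * mj -> f * dm = (e * I * mi - li) * mj -> f * pi = q * mi ->
  fj * pi + f * pji = qj * mi + q * dm ->
  f ^+ 2 * pji = q2 * mj * mi + q * ((e * I * mi - li) * mj) - q * fj * mi.
Proof.
move=> hq hm hp h.
transitivity (f * (fj * pi + f * pji) - fj * (f * pi)); first by ring.
by rewrite h -hm -hq hp; ring.
Qed.

(** The product of the two first derivatives contributes $2q^2m_jm_i$, which together with the
    second derivative completes the coefficient of $m_jm_i$ to $\sigma+\varepsilon$. *)
Lemma gmx_conformal_scalar (K : numFieldType)
    (f pi pj pji gji lj li mj mi e q2 q I ep : K) :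
  f * pi = q * mi -> f * pj = q * mj -> f != 0 ->
  lj * li + ep * mj * mi = 2^-1 * gji ->
  f ^+ 2 * pji = q2 * mj * mi + q * ((ep * I * mi - li) * mj) - q * lj * mi ->
  2^-1 * (e ^+ 2 * (2 * pj * (2 * pi * f ^+ 2 + 2 * f * li) + 2 * pji * f ^+ 2
    + 2 * pi * (2 * f * lj) + gji)) =
  e ^+ 2 * (lj * li + q * (lj * mi + mj * li)
    + (q2 + ep * I * q + 2 * q ^+ 2 + ep) * mj * mi).
Proof.
move=> hi hj f0 hg h2.
transitivity (e ^+ 2 * (2 * (f * pj) * (f * pi) + 2 * (f * pj) * li
  + f ^+ 2 * pji + 2 * (f * pi) * lj + 2^-1 * gji)); first by field.
by rewrite hi hj h2 -hg; ring.
Qed.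

(** In the coframe $(l,m)$ the form has matrix with rows $(1,q)$ and $(q,\sigma+\varepsilon)$, up to
    the factor $e^2$; the change of basis has determinant $s$. *)
Lemma det_frame_neq0 (K : fieldType) (sg e q l0 l1 m0 m1 s ep : K) :
  sg + ep - q ^+ 2 != 0 -> s != 0 -> l0 * m1 - l1 * m0 = s -> e != 0 ->
  e ^+ 2 * (l0 * l0 + q * (l0 * m0 + m0 * l0) + (sg + ep) * m0 * m0)
  * (e ^+ 2 * (l1 * l1 + q * (l1 * m1 + m1 * l1) + (sg + ep) * m1 * m1))
  - e ^+ 2 * (l0 * l1 + q * (l0 * m1 + m0 * l1) + (sg + ep) * m0 * m1)
  * (e ^+ 2 * (l1 * l0 + q * (l1 * m0 + m1 * l0) + (sg + ep) * m1 * m0)) != 0.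
Proof.
move=> n0 s0 w e0; rewrite (_ : _ - _ =
  (e ^+ 2 * (l0 * m1 - l1 * m0)) ^+ 2 * (sg + ep - q ^+ 2)); last by ring.
by rewrite w mulf_neq0 // expf_neq0 // mulf_neq0 // expf_neq0.
Qed.

(** [X], [D] are the $x$-derivatives of $\phi$, $F^2$ and [p] the $y$-derivatives of $\phi$; [XX],
    [DD], [pp] are their derivatives along $y^j$, [gg] that of $\dot\partial F^2$, and [H] that of
    the spray [G]. The terms in [H] cancel between the third and fifth hypotheses. *)
Lemma spray_rhs_conformal_scalar (K : numFieldType)
    (f e c c2 k q y0 y1 X0 X1 Y0 Y1 XX0 XX1 D0 D1 DD0 DD1 p0 p1 pp0 pp1
     l0 l1 lj mj pj xj dj H0 H1 G0 G1 g0 g1 gg0 gg1 : K) :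
  f * c = y0 * X0 + y1 * X1 - 2 * (G0 * p0 + G1 * p1) ->
  y0 * D0 + y1 * D1 = 4 * f * (l0 * G0 + l1 * G1) ->
  y0 * XX0 + y1 * XX1 = lj * c + c2 * mj - xj
    + 2 * (H0 * p0 + G0 * pp0 + (H1 * p1 + G1 * pp1)) ->
  g0 * G0 + g1 * G1 = 4^-1 * (y0 * DD0 + y1 * DD1 - dj) ->
  xj = c * lj + k * mj + (H0 * p0 + H1 * p1) ->
  f * pj = q * mj -> g0 = 2^-1 * gg0 -> g1 = 2^-1 * gg1 ->
  4^-1 *
  (y0 * (e ^+ 2 * (2 * pj * (2 * X0 * f ^+ 2 + D0) + 2 * XX0 * f ^+ 2
      + 2 * X0 * (2 * f * lj) + DD0))
   + y1 * (e ^+ 2 * (2 * pj * (2 * X1 * f ^+ 2 + D1) + 2 * XX1 * f ^+ 2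
      + 2 * X1 * (2 * f * lj) + DD1))
   - e ^+ 2 * (2 * xj * f ^+ 2 + dj)) =
  2^-1 * (e ^+ 2 * (2 * pj * (2 * p0 * f ^+ 2 + 2 * f * l0) + 2 * pp0 * f ^+ 2
      + 2 * p0 * (2 * f * lj) + gg0)) * G0
  + 2^-1 * (e ^+ 2 * (2 * pj * (2 * p1 * f ^+ 2 + 2 * f * l1) + 2 * pp1 * f ^+ 2
      + 2 * p1 * (2 * f * lj) + gg1)) * G1
  + 2^-1 * e ^+ 2 * f ^+ 2 * (c * lj + (2 * q * c + c2 - 2 * k) * mj).
Proof.
move=> hS hB hC hD hx hp hg0 hg1.
have {}hS : y0 * X0 + y1 * X1 = f * c + 2 * (G0 * p0 + G1 * p1).
  by rewrite hS subrK.
have {}hD : y0 * DD0 + y1 * DD1 - dj = 2 * (gg0 * G0 + gg1 * G1).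
  transitivity (4 * (g0 * G0 + g1 * G1)); first by rewrite hD; field.
  by rewrite hg0 hg1; field.
transitivity (4^-1 * e ^+ 2 * (2 * pj * (2 * f ^+ 2 * (y0 * X0 + y1 * X1)
  + (y0 * D0 + y1 * D1)) + 2 * f ^+ 2 * (y0 * XX0 + y1 * XX1)
  + 4 * f * lj * (y0 * X0 + y1 * X1) + (y0 * DD0 + y1 * DD1 - dj)
  - 2 * f ^+ 2 * xj)); first by ring.
rewrite hS hB hC hD hx.
have -> : (2 * q * c + c2 - 2 * k) * mj = 2 * c * (f * pj) + (c2 - 2 * k) * mj.
  by rewrite hp; ring.
by field.
Qed.

Lemma wedge_div (K : fieldType) (l0 l1 m0 m1 e s : K) : s != 0 ->
  l0 * m1 - l1 * m0 = s -> m0 * (- e * l1 / s) + m1 * (e * l0 / s) = e.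
Proof.
move=> s0 w; transitivity (e * (l0 * m1 - l1 * m0) / s); first by ring.
by rewrite w mulfK.
Qed.

(** With [u] for $m^i$ and [v] for $\ell^i$, the $l_j$-component is $P+\varepsilon qQ$, which
    explains the choice of [P]. Substituting it leaves $\varepsilon Q(\sigma+\varepsilon-q^2)$ in
    the $m_j$-component, which explains [Q]. *)
Lemma spray_conformal_scalar (K : numFieldType)
    (f e c c2 k q sg ep P Q G0 G1 u0 u1 v0 v1 l0 l1 m0 m1 lj mj : K) :
  sg + ep - q ^+ 2 != 0 -> ep ^+ 2 = 1 ->
  l0 * u0 + l1 * u1 = 0 -> m0 * u0 + m1 * u1 = ep ->
  l0 * v0 + l1 * v1 = 1 -> m0 * v0 + m1 * v1 = 0 ->
  Q = 2^-1 * (ep * (sg + ep - q ^+ 2)^-1 * f ^+ 2 * (q * c + c2 - 2 * k)) ->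
  P = 2^-1 * f ^+ 2 * c - ep * q * Q ->
  let b l m := e ^+ 2 * (lj * l + q * (lj * m + mj * l) + (sg + ep) * mj * m) in
  b l0 m0 * (G0 + Q * u0 + P * v0) + b l1 m1 * (G1 + Q * u1 + P * v1) =
  b l0 m0 * G0 + b l1 m1 * G1
  + 2^-1 * e ^+ 2 * f ^+ 2 * (c * lj + (2 * q * c + c2 - 2 * k) * mj).
Proof.
move=> n0 ep2 lu mu lv mv hQ hP /=.
have hQ' : ep * Q * (sg + ep - q ^+ 2) = 2^-1 * f ^+ 2 * (q * c + c2 - 2 * k).
  transitivity (ep ^+ 2 * (2^-1 * f ^+ 2 * (q * c + c2 - 2 * k))).
    by rewrite hQ; field.
  by rewrite ep2 mul1r.
transitivity (
  e ^+ 2 * (lj * l0 + q * (lj * m0 + mj * l0) + (sg + ep) * mj * m0) * G0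
  + e ^+ 2 * (lj * l1 + q * (lj * m1 + mj * l1) + (sg + ep) * mj * m1) * G1
  + e ^+ 2 * (Q * ((lj + q * mj) * (l0 * u0 + l1 * u1)
                   + (q * lj + (sg + ep) * mj) * (m0 * u0 + m1 * u1))
              + P * ((lj + q * mj) * (l0 * v0 + l1 * v1)
                   + (q * lj + (sg + ep) * mj) * (m0 * v0 + m1 * v1)))).
  by ring.
rewrite lu mu lv mv hP; congr (_ + _).
transitivity (e ^+ 2 * (2^-1 * f ^+ 2 * c * (lj + q * mj)
  + (ep * Q * (sg + ep - q ^+ 2)) * mj)); first by ring.
by rewrite hQ'; ring.
Qed.

(** * The Berwald frame *)

Section Frame.
Context (R : realType).
Local Notation point := ('rV[R]_2 * 'rV[R]_2)%type.
Variables (U : set point) (F : point -> R).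
Hypotheses (oU : open U) (cU : yconic U) (sF : smooth_on U F)
  (hF : homogeneous_on U 1 F) (F_neq0 : forall z, U z -> F z != 0)
  (det_neq0 : forall z, U z -> \det (gmx F z) != 0).
Implicit Types (z : point) (i j k : 'I_2).

Local Notation P := (fun w => F w ^+ 2).
Local Notation p i := (dy i P).
Local Notation det := (fun z => \det (gmx F z)).

Local Notation vol := (vol F).

(** * Regularity and homogeneity of $F^2$ and its derivatives *)

Lemma diff_F z : U z -> differentiable F z. Proof. exact: smooth_diff0. Qed.
Lemma diff_dyF i z : U z -> differentiable (dy i F) z.
Proof. exact: smooth_diff1. Qed.
Lemma diff_F2 z : U z -> differentiable P z. Proof. exact: diff_sqr. Qed.
Lemma dp i z : U z -> differentiable (p i) z.
Proof. exact: diff_derive_sqr. Qed.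
Lemma diff_dydyF2 i j z : U z -> differentiable (dy j (p i)) z.
Proof. exact: diff_derive_derive_sqr. Qed.
Lemma diff_dxF2 i z : U z -> differentiable (dx i P) z.
Proof. exact: diff_derive_sqr. Qed.
Lemma diff_dydxF2 i j z : U z -> differentiable (dy j (dx i P)) z.
Proof. exact: diff_derive_derive_sqr. Qed.

Lemma F2_homogeneous : homogeneous_on U 2 P.
Proof. by move=> z t Uz t0; rewrite hF // exprMn expr1. Qed.
Lemma dyF2_homogeneous i : homogeneous_on U 1 (p i).
Proof. exact: (homogeneous_dy _ oU cU (@diff_F2) F2_homogeneous). Qed.
Lemma dydyF2_homogeneous i j : homogeneous_on U 0 (dy j (p i)).
Proof. exact: (homogeneous_dy _ oU cU (@dp i) (@dyF2_homogeneous i)). Qed.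
Lemma dxF2_homogeneous i : homogeneous_on U 2 (dx i P).
Proof. exact: (homogeneous_dx _ oU (@diff_F2) F2_homogeneous). Qed.
Lemma dydxF2_homogeneous i j : homogeneous_on U 1 (dy j (dx i P)).
Proof. exact: (homogeneous_dy _ oU cU (@diff_dxF2 i) (@dxF2_homogeneous i)). Qed.

Lemma dyF2E i z : U z -> p i z = 2 * F z * dy i F z.
Proof. exact: derive_sqr. Qed.

Lemma m_low0 z : m_low F 0 z = - vol z * ycoord 1 z / F z.
Proof. by rewrite /m_low /= mulrA. Qed.

Lemma m_low1 z : m_low F 1 z = vol z * ycoord 0 z / F z.
Proof. by rewrite /m_low /= mulrA. Qed.

Local Opaque dy dx gmx ycoord m_low.

(** * Euler identities and symmetry of the metric *)

Lemma euler_F z : U z -> ycoord 0 z * dy 0 F z + ycoord 1 z * dy 1 F z = F z.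
Proof.
by move=> Uz; have := euler oU Uz (diff_F Uz) hF; rewrite sum_ord2 mul1r.
Qed.

Lemma euler_F2 z : U z -> \sum_i ycoord i z * p i z = 2 * P z.
Proof. by move=> Uz; exact: (euler oU Uz (diff_F2 Uz) F2_homogeneous). Qed.

(** Differentiating $y^k\dot\partial_kF^2=2F^2$ along $y^i$ gives
    $y^k\dot\partial_i\dot\partial_kF^2=\dot\partial_iF^2$. *)
Lemma gmx_y i z : U z ->
  gmx F z i 0 * ycoord 0 z + gmx F z i 1 * ycoord 1 z = F z * dy i F z.
Proof.
move=> Uz; have D : has_grad (fun w => 2 * P w) z _ :=
  has_gradM (has_grad_cst 2 z) (has_grad_self (diff_F2 Uz)).
have E : dy i (fun w => \sum_i ycoord i w * p i w) z = 2 * p i z.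
  by rewrite (has_grad_dy _ (has_grad_eq_on oU Uz (@euler_F2) D)) mul0r add0r.
move: E; rewrite (@dy_ycontract _ (fun k => p k)); last by move=> k; exact: dp.
by rewrite sum_ord2 /= !gmxE dyF2E //; atoms F z; lra.
Qed.

(** [gmx_y] contracts the inner derivative with $y$; Euler's identity for $\dot\partial_iF^2$, of
    degree one, contracts the outer one. Both contractions equal $F\ell_i$. *)
Lemma gmx_sym z : U z -> gmx F z 0 1 = gmx F z 1 0.
Proof.
move=> Uz.
have h i : gmx F z 0 i * ycoord 0 z + gmx F z 1 i * ycoord 1 z = F z * dy i F z.
  have := euler oU Uz (@dp i z Uz) (@dyF2_homogeneous i).
  rewrite sum_ord2 !gmxE mul1r dyF2E //; atoms F z => H; lra.
have h0 := h 0; have h1 := h 1.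
have k0 := gmx_y 0 Uz; have k1 := gmx_y 1 Uz.
move: h0 h1 k0 k1 (F_neq0 Uz) (euler_F Uz); atoms F z; exact: sym_of_contractions.
Qed.

Lemma diff_gmx i j z : U z -> differentiable (fun w => gmx F w i j) z.
Proof.
move=> Uz; have [+ _] := has_gradM (has_grad_cst 2^-1 z)
  (has_grad_self (@diff_dydyF2 j i z Uz)).
by congr (differentiable _ z); apply: funext => w; rewrite gmxE.
Qed.

Lemma gmx_yscale z (t : R) : U z -> 0 < t -> gmx F (yscale t z) = gmx F z.
Proof.
move=> Uz t0; apply/matrixP => i j.
have h := dydyF2_homogeneous j i Uz t0; rewrite expr0 mul1r in h.
exact: etrans (gmxE F i j _) (etrans (congr1 _ h) (esym (gmxE F i j z))).
Qed.

Lemma det_gmxE : det = fun z => gmx F z 0 0 * gmx F z 1 1 - gmx F z 0 1 * gmx F z 1 0.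
Proof. by apply: funext => z; exact: det_mx2. Qed.

Lemma diff_det z : U z -> differentiable det z.
Proof.
move=> Uz; have D i j := has_grad_self (diff_gmx i j Uz); rewrite det_gmxE.
by have [] := has_gradB (has_gradM (D 0 0) (D 1 1)) (has_gradM (D 0 1) (D 1 0)).
Qed.

(** * The signature and the area density *)

Lemma sqr_eps z : U z -> eps F z ^+ 2 = 1.
Proof. by move=> Uz; rewrite /eps sqr_sg det_neq0. Qed.

Lemma eps_yscale z (t : R) : U z -> 0 < t -> eps F (yscale t z) = eps F z.
Proof. by move=> Uz t0; rewrite /eps gmx_yscale. Qed.

Lemma eps_mul_det z : eps F z * \det (gmx F z) = `|\det (gmx F z)|.
Proof. by rewrite /eps -normrEsg. Qed.

Lemma vol_gt0 z : U z -> 0 < vol z.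
Proof. by move=> Uz; rewrite sqrtr_gt0 eps_mul_det normr_gt0 det_neq0. Qed.

Lemma sqr_vol z : U z -> vol z ^+ 2 = eps F z * \det (gmx F z).
Proof. by move=> Uz; rewrite sqr_sqrtr // eps_mul_det. Qed.

Lemma vol_yscale z (t : R) : U z -> 0 < t -> vol (yscale t z) = vol z.
Proof. by move=> Uz t0; rewrite /vol (eps_yscale Uz t0) (gmx_yscale Uz t0). Qed.

(* Writing [vol] as the fourth root of [det ^+ 2] avoids differentiating [eps]. *)
Lemma volE : vol = fun z => Num.sqrt (Num.sqrt (\det (gmx F z) ^+ 2)).
Proof. by apply: funext => z; rewrite sqrtr_sqr -eps_mul_det. Qed.

Lemma has_grad_vol z : U z ->
  has_grad vol z (fun v => eps F z * 'D_v det z / (2 * vol z)).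
Proof.
move=> Uz; have d2 := has_gradX2 (has_grad_self (diff_det Uz)).
have d0 : 0 < \det (gmx F z) ^+ 2 by rewrite exprn_even_gt0 //= det_neq0.
have d0' : 0 < Num.sqrt (\det (gmx F z) ^+ 2) by rewrite sqrtr_gt0.
have d3 := has_grad_sqrt (f := fun w => \det (gmx F w) ^+ 2) d0 d2.
have [d E] := has_grad_sqrt
  (f := fun w => Num.sqrt (\det (gmx F w) ^+ 2)) d0' d3.
split=> [|v]; rewrite volE // E; congr (_ / _).
rewrite sqrtr_sqr -eps_mul_det.
have e0 : eps F z != 0 by rewrite sgr_eq0 det_neq0.
move: (sqr_eps Uz) (det_neq0 Uz) e0.
by atoms F z => e2 b0 c0; exact: half_mul_div.
Qed.

Lemma diff_vol z : U z -> differentiable vol z.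
Proof. by move=> Uz; have [] := has_grad_vol Uz. Qed.

(** * Frame decomposition of the metric and of covectors *)

Lemma gmx_frame i j z : U z ->
  gmx F z i j = dy i F z * dy j F z + eps F z * m_low F i z * m_low F j z.
Proof.
move=> Uz; have es : eps F z * vol z ^+ 2 =
    gmx F z 0 0 * gmx F z 1 1 - gmx F z 1 0 ^+ 2.
  by rewrite sqr_vol // mulrA -expr2 sqr_eps // mul1r det_mx2 (gmx_sym Uz) -expr2.
have := metric_frame (gmx_y 0 Uz) (gmx_y 1 Uz) (euler_F Uz).
move=> /(_ (gmx_sym Uz) _ _ es (F_neq0 Uz)) /= [h00 h01 h10 h11].
by elim/ord2P: i; elim/ord2P: j; rewrite ?(gmx_sym Uz) ?m_low0 ?m_low1.
Qed.

Lemma m_low_wedge z : U z ->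
  dy 0 F z * m_low F 1 z - dy 1 F z * m_low F 0 z = vol z.
Proof.
move=> Uz; have f0 := F_neq0 Uz; rewrite m_low0 m_low1.
transitivity (vol z * (ycoord 0 z * dy 0 F z + ycoord 1 z * dy 1 F z) / F z).
  by move: (vol z) => c; atoms F z; ring.
by rewrite euler_F // mulfK.
Qed.

(** Up to the factor $\varepsilon/\sqrt{|\det g|}$, the vector $m^i$ is $\ell_i$ rotated by a right
    angle. It is recognized as the solution of $g_{ij}m^j=m_i$. *)
Definition m_up_expr i z : R :=
  if i == 0 then - eps F z * dy 1 F z / vol z else eps F z * dy 0 F z / vol z.

Lemma m_upE i z : U z -> m_up F i z = m_up_expr i z.
Proof.
move=> Uz; rewrite /m_up /ginv.
apply: (invmx_mulE (X := fun i => m_up_expr i z) (det_neq0 Uz)) => {}i.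
rewrite sum_ord2 (gmx_frame i 0 Uz) (gmx_frame i 1 Uz).
rewrite [m_up_expr 0 z]/(- eps F z * dy 1 F z / vol z).
rewrite [m_up_expr 1 z]/(eps F z * dy 0 F z / vol z).
move: (sqr_eps Uz) (lt0r_neq0 (vol_gt0 Uz)) (m_low_wedge Uz); atoms F z.
exact: frame_dual.
Qed.

Lemma m_up0 z : U z -> m_up F 0 z = - eps F z * dy 1 F z / vol z.
Proof. by move=> Uz; rewrite (m_upE 0 Uz). Qed.

Lemma m_up1 z : U z -> m_up F 1 z = eps F z * dy 0 F z / vol z.
Proof. by move=> Uz; rewrite (m_upE 1 Uz). Qed.

Lemma covector_frame (w : 'I_2 -> R) j z : U z ->
  w j = (\sum_i w i * ell_up F i z) * dy j F z
    + eps F z * (\sum_i w i * m_up F i z) * m_low F j z.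
Proof.
move=> Uz; rewrite !sum_ord2 /ell_up (m_up0 Uz) (m_up1 Uz).
have [h0 h1] := covector_frame_expand (w 0) (w 1) (sqr_eps Uz)
  (lt0r_neq0 (vol_gt0 Uz)) (F_neq0 Uz) (euler_F Uz).
by elim/ord2P: j; rewrite ?m_low0 ?m_low1.
Qed.

Lemma sum_ell_up (w : 'I_2 -> R) z :
  \sum_i w i * ell_up F i z = (\sum_i ycoord i z * w i) / F z.
Proof.
rewrite mulr_suml; apply: eq_bigr => i _.
by rewrite /ell_up mulrA [w i * _]mulrC.
Qed.

(** The Euler condition kills the $\ell$-component of $\dot\partial_jf$; the $m$-component is
    $f_{;2}$ up to the factor $F$. *)
Lemma dy_sc2 f j z : U z -> \sum_i ycoord i z * dy i f z = 0 ->
  F z * dy j f z = sc2 F f z * m_low F j z.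
Proof.
move=> Uz f0; rewrite (covector_frame (fun i => dy i f z) j Uz).
rewrite sum_ell_up f0 mul0r mul0r add0r /sc2.
by move: (\sum_i _) => a; rewrite mulrA mulrA [F z * _]mulrC.
Qed.

(** The signs in [sc2] and in $m^i$ cancel by $\varepsilon^2=1$, leaving an expression that the
    derivative rules handle directly. *)
Definition sc2_expr f z : R :=
  F z * (dy 1 f z * dy 0 F z - dy 0 f z * dy 1 F z) / vol z.

Lemma sc2E f z : U z -> sc2 F f z = sc2_expr f z.
Proof.
move=> Uz; rewrite /sc2 sum_ord2 (m_up0 Uz) (m_up1 Uz) /sc2_expr.
have := sqr_eps Uz; atoms F z; exact: sc2_scalar.
Qed.

(** * The Cartan tensor and the main scalar *)

Lemma dy_gmx_sym i j k z : U z ->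
  dy k (fun w => gmx F w i j) z = dy k (fun w => gmx F w j i) z.
Proof.
move=> Uz.
have E w : U w -> gmx F w i j = gmx F w j i.
  by move=> Uw; elim/ord2P: i; elim/ord2P: j; rewrite ?(gmx_sym Uw).
exact: (has_grad_dy k (has_grad_eq_on oU Uz E (has_grad_self (diff_gmx j i Uz)))).
Qed.

(** Differentiating $g_{ij}y^j=\tfrac12\dot\partial_iF^2$ along $y^k$ produces $g_{ik}$ on the left
    and $g_{ki}$ on the right, which cancel by symmetry. *)
Lemma dy_gmx_y i k z : U z ->
  \sum_j ycoord j z * dy k (fun w => gmx F w i j) z = 0.
Proof.
move=> Uz.
have E w : U w -> \sum_j ycoord j w * gmx F w i j = 2^-1 * p i w.
  move=> Uw; have := gmx_y i Uw; rewrite sum_ord2 dyF2E //.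
  by atoms F w => h; rewrite -mulrA mulKf ?pnatr_eq0 // -h; ring.
have D := has_gradM (has_grad_cst 2^-1 z) (has_grad_self (dp i Uz)).
have := has_grad_dy k (has_grad_eq_on oU Uz E D).
rewrite (@dy_ycontract _ (fun j w => gmx F w i j)); last by move=> j; exact: diff_gmx.
rewrite mul0r add0r => h.
have s_ik : gmx F z i k = gmx F z k i.
  by elim/ord2P: i {E D h}; elim/ord2P: k; rewrite ?(gmx_sym Uz).
apply: (addrI (gmx F z i k)); rewrite addr0 h s_ik gmxE //.
Qed.

Lemma y_dy_gmx i j z : U z ->
  \sum_k ycoord k z * dy k (fun w => gmx F w i j) z = 0.
Proof.
move=> Uz.
have h : homogeneous_on U 0 (fun w => gmx F w i j).
  by move=> w t Uw t0; rewrite expr0 mul1r (gmx_yscale Uw t0).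
by rewrite (euler oU Uz (diff_gmx i j Uz) h) mul0r.
Qed.

Lemma covector_m (w : 'I_2 -> R) j z : U z ->
  \sum_i ycoord i z * w i = 0 ->
  w j = eps F z * (\sum_i w i * m_up F i z) * m_low F j z.
Proof.
by move=> Uz w0; rewrite {1}(covector_frame w j Uz) sum_ell_up w0 !mul0r add0r.
Qed.

(** As the main scalar is chosen by [xget], a suitable value must be exhibited. The derivative of
    $g_{ij}$ vanishes on $y$ in each slot: the last by homogeneity, the second by [dy_gmx_y], the
    first by symmetry in $i,j$. So each slot is a multiple of $m$. *)
Lemma main_scalarP i j k z : U z ->
  F z * cartan F i j k z =
  main_scalar F z * m_low F i z * m_low F j z * m_low F k z.
Proof.
move=> Uz; pose T i j k := dy k (fun w => gmx F w i j) z.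
pose T1 i j := \sum_k T i j k * m_up F k z.
pose T2 i := \sum_j T1 i j * m_up F j z.
have y1 a : \sum_j ycoord j z * T1 a j = 0.
  rewrite /T1; under eq_bigr do rewrite mulr_sumr.
  rewrite exchange_big /= big1 // => c _.
  under eq_bigr do rewrite mulrA.
  by rewrite -mulr_suml dy_gmx_y // mul0r.
have y2 : \sum_a ycoord a z * T2 a = 0.
  rewrite /T2; under eq_bigr do rewrite mulr_sumr.
  rewrite exchange_big /= big1 // => c _.
  under eq_bigr do rewrite mulrA.
  rewrite -mulr_suml (_ : \sum_(i < 2) _ = 0) ?mul0r //.
  apply: etrans (y1 c); apply: eq_bigr => a _; congr (_ * _).
  rewrite /T1; apply: eq_bigr => b _; congr (_ * _); exact: dy_gmx_sym.
have TE a b c : T a b c =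
    eps F z ^+ 3 * (\sum_d T2 d * m_up F d z)
    * m_low F a z * m_low F b z * m_low F c z.
  have e1 := covector_m (w := T a b) c Uz (y_dy_gmx a b Uz).
  have e2 := covector_m (w := T1 a) b Uz (y1 a).
  have e3 := covector_m (w := T2) a Uz y2.
  rewrite e1 -/(T1 a b) e2 -/(T2 a) e3.
  by move: (\sum_d _) => t; atoms F z; ring.
rewrite /main_scalar; case: xgetP => [I _ HI|H]; first exact: HI.
(* Each of the three expansions along $m$ contributes a factor $\varepsilon$; the $\tfrac12$ comes
   from the Cartan tensor. *)
exfalso; apply: (H (F z * 2^-1 * (eps F z ^+ 3 * (\sum_d T2 d * m_up F d z)))).
move=> a b c; rewrite /cartan -/(T a b c) TE.
by move: (\sum_d _) => t; atoms F z; ring.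
Qed.

Lemma dy_gmx i j k z : U z ->
  dy k (fun w => gmx F w i j) z =
  2 * main_scalar F z * m_low F i z * m_low F j z * m_low F k z / F z.
Proof.
move=> Uz; apply: (mulfI (F_neq0 Uz)).
have := main_scalarP i j k Uz; rewrite /cartan.
move: (main_scalar F z) (F_neq0 Uz) => I; atoms F z.
exact: half_div_eq.
Qed.

(** * Vertical derivatives of the area density and of $m_i$ *)

Lemma dy_vol j z : U z ->
  F z * dy j vol z = eps F z * main_scalar F z * m_low F j z * vol z.
Proof.
move=> Uz; have D i j := has_grad_self (diff_gmx i j Uz).
have := has_grad_dy j (has_gradB (has_gradM (D 0 0) (D 1 1))
  (has_gradM (D 0 1) (D 1 0))); rewrite /= -det_gmxE.
rewrite !dyE !(dy_gmx _ _ j Uz).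
rewrite (gmx_frame 0 0 Uz) (gmx_frame 0 1 Uz) (gmx_frame 1 0 Uz) (gmx_frame 1 1 Uz).
have := has_grad_dy j (has_grad_vol Uz); rewrite /= !dyE.
move: (main_scalar F z) (F_neq0 Uz) (lt0r_neq0 (vol_gt0 Uz)) (m_low_wedge Uz) => I.
atoms F z.
exact: dy_vol_scalar.
Qed.

Lemma diff_m_low i z : U z -> differentiable (m_low F i) z.
Proof.
move=> Uz; have Dv := has_grad_self (diff_vol Uz).
have DV := has_gradV (F_neq0 Uz) (has_grad_self (diff_F Uz)).
elim/ord2P: i.
  have [+ _] := has_gradM (has_gradM (has_gradN Dv) (has_grad_ycoord 1 z)) DV.
  by congr (differentiable _ z); apply: funext => w; rewrite m_low0.
have [+ _] := has_gradM (has_gradM Dv (has_grad_ycoord 0 z)) DV.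
by congr (differentiable _ z); apply: funext => w; rewrite m_low1.
Qed.

Lemma dy_m_low i j z : U z ->
  F z * dy j (m_low F i) z =
  (eps F z * main_scalar F z * m_low F i z - dy i F z) * m_low F j z.
Proof.
move=> Uz; have Dv := has_grad_self (diff_vol Uz).
have DV := has_gradV (F_neq0 Uz) (has_grad_self (diff_F Uz)).
have n0 : m_low F 0 = fun w => - vol w * ycoord 1 w / F w.
  by apply: funext => w; exact: m_low0.
have n1 : m_low F 1 = fun w => vol w * ycoord 0 w / F w.
  by apply: funext => w; exact: m_low1.
have e0 := has_grad_dy j
  (has_gradM (has_gradM (has_gradN Dv) (has_grad_ycoord 1 z)) DV).
have e1 := has_grad_dy j (has_gradM (has_gradM Dv (has_grad_ycoord 0 z)) DV).
rewrite /= -n0 !dyE !mxE /= in e0; rewrite /= -n1 !dyE !mxE /= in e1.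
have := dy_vol j Uz.
elim/ord2P: i; rewrite ?e0 ?e1.
  have := m_low_wedge Uz; have := m_low0 z; have := F_neq0 Uz.
  move: (main_scalar F z) => I.
  elim/ord2P: j {e0 e1} => /=; atoms F z => f0 m w;
    by apply: dy_m_low_scalar0 => //; rewrite -?w; ring.
have := m_low_wedge Uz; have := m_low1 z; have := F_neq0 Uz.
move: (main_scalar F z) => I.
elim/ord2P: j {e0 e1} => /=; atoms F z => f0 m w;
  by apply: dy_m_low_scalar1 => //; rewrite -?w; ring.
Qed.

(** * The geodesic spray: contraction, homogeneity, regularity *)

Lemma y_gmx_sum (X : 'I_2 -> R) z : U z ->
  \sum_i ycoord i z * (\sum_j gmx F z i j * X j) =
  F z * (\sum_j dy j F z * X j).
Proof.
move=> Uz; rewrite !sum_ord2 -(gmx_sym Uz); have k1 := gmx_y 1 Uz.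
move: (gmx_y 0 Uz) k1; rewrite -(gmx_sym Uz).
move: (X 0) (X 1) => a b; atoms F z; exact: contraction_sum.
Qed.

Lemma spray_system_F i z : U z ->
  \sum_j gmx F z i j * spray F j z = 4^-1 * spray_rhs F i z.
Proof. by move=> Uz; exact: spray_system (det_neq0 Uz). Qed.

(** The spray system is contracted with $y$. Since $\partial_kF^2$ has degree two, its right-hand
    side becomes $2y^k\partial_kF^2-y^k\partial_kF^2$. *)
Lemma sum_y_dxF2 z : U z ->
  \sum_k ycoord k z * dx k P z = 4 * F z * (\sum_j dy j F z * spray F j z).
Proof.
move=> Uz; have := y_gmx_sum (fun j => spray F j z) Uz.
have E : \sum_i ycoord i z * spray_rhs F i z = \sum_k ycoord k z * dx k P z.
  rewrite /spray_rhs; under eq_bigr do rewrite mulrBr mulr_sumr.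
  rewrite sumrB exchange_big /=.
  have e k : \sum_i ycoord i z * (ycoord k z * dy i (dx k P) z) =
      2 * (ycoord k z * dx k P z).
    under eq_bigr do rewrite mulrCA.
    by rewrite -mulr_sumr (euler oU Uz (diff_dxF2 k Uz) (@dxF2_homogeneous k)) mulrCA.
  under eq_bigr do rewrite e.
  by rewrite -mulr_sumr; move: (\sum_i _) => a; ring.
under eq_bigr do rewrite spray_system_F // mulrCA.
rewrite -mulr_sumr E => h; rewrite -!mulrA -h.
by move: (\sum_k _) => a; field.
Qed.

Lemma spray_rhs_yscale i z (t : R) : U z -> 0 < t ->
  spray_rhs F i (yscale t z) = t ^+ 2 * spray_rhs F i z.
Proof.
move=> Uz t0; rewrite /spray_rhs (dxF2_homogeneous i Uz t0) mulrBr; congr (_ - _).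
rewrite mulr_sumr; apply: eq_bigr => k _; rewrite (dydxF2_homogeneous k i Uz t0).
have -> : ycoord k (yscale t z) = t * ycoord k z by exact: mxE.
by move: (dy i _ z) (ycoord k z) => a b; ring.
Qed.

Lemma spray_homogeneous i : homogeneous_on U 2 (spray F i).
Proof.
move=> z t Uz t0; rewrite /spray /ginv gmx_yscale // !mulr_sumr.
apply: eq_bigr => k _.
rewrite -[_ - _ in LHS]/(spray_rhs F k (yscale t z)) spray_rhs_yscale //.
rewrite -[_ - _ in RHS]/(spray_rhs F k z).
by move: (invmx _ _ _) (spray_rhs F k z) => a b; ring.
Qed.

(** Cramer's rule for the spray system, a form in which differentiability is visible. *)
Definition spray_expr i z : R :=
  (if i == 0 then gmx F z 1 1 * spray_rhs F 0 z - gmx F z 0 1 * spray_rhs F 1 z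
   else gmx F z 0 0 * spray_rhs F 1 z - gmx F z 1 0 * spray_rhs F 0 z)
  * (4 * \det (gmx F z))^-1.

Lemma sprayE i z : U z -> spray F i z = spray_expr i z.
Proof.
move=> Uz; apply: (spray_unique (X := fun i => spray_expr i z) (det_neq0 Uz)).
move=> {}i; rewrite sum_ord2 /spray_expr /=.
move: (det_neq0 Uz); rewrite det_mx2.
by elim/ord2P: i; move: (spray_rhs F 0 z) (spray_rhs F 1 z) => a b;
  atoms F z => n0; field.
Qed.

Lemma diff_spray i z : U z -> differentiable (spray F i) z.
Proof.
move=> Uz.
have Dr k : differentiable (spray_rhs F k) z.
  have Dk l := has_gradM (has_grad_ycoord l z) (has_grad_self (diff_dydxF2 l k Uz)).
  by have [] := has_gradB (has_grad_sum2 Dk) (has_grad_self (diff_dxF2 k Uz)).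
have Dr' k := has_grad_self (Dr k).
have Dg k l := has_grad_self (diff_gmx k l Uz).
have n4 : 4 * \det (gmx F z) != 0 by rewrite mulf_neq0 ?pnatr_eq0 ?det_neq0.
have DV := has_gradV (f := fun w => 4 * \det (gmx F w)) n4
  (has_gradM (has_grad_cst 4 z) (has_grad_self (diff_det Uz))).
elim/ord2P: i.
  have D := has_gradM (has_gradB (has_gradM (Dg 1 1) (Dr' 0))
    (has_gradM (Dg 0 1) (Dr' 1))) DV.
  by have [] := has_grad_eq_on oU Uz (@sprayE 0) D.
have D := has_gradM (has_gradB (has_gradM (Dg 0 0) (Dr' 1))
    (has_gradM (Dg 1 0) (Dr' 0))) DV.
by have [] := has_grad_eq_on oU Uz (@sprayE 1) D.
Qed.

(** * The conformal change *)

Section Conformal.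
Variable phi : point -> R.
Hypotheses (sphi : smooth_on U phi) (hphi : homogeneous_on U 0 phi).

Local Notation q := (sc2 F phi).
Local Notation c := (co1 F phi).

Lemma diff_phi z : U z -> differentiable phi z.
Proof. exact: smooth_diff0. Qed.

Lemma diff_dy_phi i z : U z -> differentiable (dy i phi) z.
Proof. exact: smooth_diff1. Qed.

Lemma diff_dx_phi i z : U z -> differentiable (dx i phi) z.
Proof. exact: smooth_diff1. Qed.

Lemma euler_phi z : U z -> \sum_i ycoord i z * dy i phi z = 0.
Proof. by move=> Uz; rewrite (euler oU Uz (diff_phi Uz) hphi) mul0r. Qed.

Lemma dy_phi i z : U z -> F z * dy i phi z = q z * m_low F i z.
Proof. by move=> Uz; rewrite dy_sc2 // euler_phi. Qed.

Lemma dy_phi_yscale i z (t : R) : U z -> 0 < t ->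
  t * dy i phi (yscale t z) = dy i phi z.
Proof.
move=> Uz t0; have := dy_yscale i oU cU (@diff_phi) hphi Uz t0.
by rewrite expr0 mul1r.
Qed.

Lemma diff_sc2_phi z : U z -> differentiable q z.
Proof.
move=> Uz; have Dp i := has_grad_self (diff_dy_phi i Uz).
have Df i := has_grad_self (diff_dyF i Uz).
have D := has_gradM (has_gradM (has_grad_self (diff_F Uz))
  (has_gradB (has_gradM (Dp 1) (Df 0)) (has_gradM (Dp 0) (Df 1))))
  (has_gradV (lt0r_neq0 (vol_gt0 Uz)) (has_grad_self (diff_vol Uz))).
by have [] := has_grad_eq_on oU Uz (@sc2E phi) D.
Qed.

(** Degree zero allows [dy_sc2] to be applied a second time, producing $\phi_{;2;2}$. *)
Lemma sc2_phi_homogeneous : homogeneous_on U 0 q.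
Proof.
move=> z t Uz t0; rewrite expr0 mul1r (sc2E phi Uz) (sc2E phi (cU Uz t0)).
rewrite /sc2_expr (vol_yscale Uz t0) (hF Uz t0) expr1.
rewrite (homogeneous_dy 0 oU cU (@diff_F) hF Uz t0).
rewrite (homogeneous_dy 1 oU cU (@diff_F) hF Uz t0).
rewrite -(dy_phi_yscale 0 Uz t0) -(dy_phi_yscale 1 Uz t0) expr0.
move: (dy 0 phi _) (dy 1 phi _) => a b; atoms F z; ring.
Qed.

Lemma dy_sc2_phi j z : U z -> F z * dy j q z = sc2 F q z * m_low F j z.
Proof.
move=> Uz; rewrite dy_sc2 //.
by rewrite (euler oU Uz (diff_sc2_phi Uz) sc2_phi_homogeneous) mul0r.
Qed.

Lemma dy_dy_phi i j z : U z ->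
  F z ^+ 2 * dy j (dy i phi) z =
  sc2 F q z * m_low F j z * m_low F i z
  + q z * ((eps F z * main_scalar F z * m_low F i z - dy i F z) * m_low F j z)
  - q z * dy j F z * m_low F i z.
Proof.
move=> Uz.
have D1 := has_gradM (has_grad_self (diff_F Uz)) (has_grad_self (diff_dy_phi i Uz)).
have D2 := has_gradM (has_grad_self (diff_sc2_phi Uz))
  (has_grad_self (diff_m_low i Uz)).
have := has_grad_dy j (has_grad_eq_on oU Uz (@dy_phi i) D2).
rewrite (has_grad_dy j D1) !dyE.
move: (dy_sc2_phi j Uz) (dy_m_low i j Uz) (dy_phi i Uz).
move: (sc2 F q z) (q z) (main_scalar F z) => q2 q1 I.
atoms F z; exact: dy_dy_phi_scalar.
Qed.

(** Each $G^l$ has degree two, so $y^k\dot\partial_kG^l=2G^l$ removes the derivatives of the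
    spray. *)
Lemma F_co1_phi z : U z -> F z * c z =
  \sum_k ycoord k z * dx k phi z - 2 * (\sum_l spray F l z * dy l phi z).
Proof.
move=> Uz; rewrite /co1 sum_ell_up mulrC mulfVK ?F_neq0 // /delta.
under eq_bigr do rewrite mulrBr mulr_sumr.
rewrite sumrB exchange_big /=; congr (_ - _).
rewrite mulr_sumr; apply: eq_bigr => l _.
under eq_bigr do rewrite mulrA.
by rewrite -mulr_suml (euler oU Uz (diff_spray l Uz) (@spray_homogeneous l)) mulrA.
Qed.

Lemma co1_phiE z : U z -> c z =
  (\sum_k ycoord k z * dx k phi z - 2 * (\sum_l spray F l z * dy l phi z))
  * (F z)^-1.
Proof. by move=> Uz; rewrite -F_co1_phi // mulrC mulKf ?F_neq0. Qed.

Lemma diff_y_dx_phi z : U z ->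
  differentiable (fun w => \sum_k ycoord k w * dx k phi w) z.
Proof.
by move=> Uz; have [] := has_grad_sum2 (fun k => has_gradM (has_grad_ycoord k z)
  (has_grad_self (diff_dx_phi k Uz))).
Qed.

Lemma has_grad_spray_phi z (Uz : U z) :
  has_grad (fun w => \sum_l spray F l w * dy l phi w) z
    (fun v => \sum_l ('D_v (spray F l) z * dy l phi z
                       + spray F l z * 'D_v (dy l phi) z)).
Proof.
exact: (has_grad_sum2 (fun l => has_gradM (has_grad_self (diff_spray l Uz))
  (has_grad_self (diff_dy_phi l Uz)))).
Qed.

Let has_grad_F_co1 z (Uz : U z) := has_gradB (has_grad_self (diff_y_dx_phi Uz))
  (has_gradM (has_grad_cst 2 z) (has_grad_spray_phi Uz)).

Lemma diff_co1_phi z : U z -> differentiable c z.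
Proof.
move=> Uz.
have D := has_gradM (has_grad_F_co1 Uz)
  (has_gradV (F_neq0 Uz) (has_grad_self (diff_F Uz))).
by have [] := has_grad_eq_on oU Uz (@co1_phiE) D.
Qed.

Lemma co1_phi_homogeneous : homogeneous_on U 0 c.
Proof.
move=> z t Uz t0; rewrite expr0 mul1r; apply: (mulfI (F_neq0 (cU Uz t0))).
(* After multiplication by $F$, of degree one, it remains to see that the right-hand side of
   [F_co1_phi] has degree one. *)
rewrite (F_co1_phi (cU Uz t0)) (hF Uz t0) expr1 -mulrA (F_co1_phi Uz) mulrBr.
rewrite !mulr_sumr; congr (_ - _).
  apply: eq_bigr => k _.
  rewrite (homogeneous_dx k oU (@diff_phi) hphi Uz t0) expr0 mul1r mulrA.
  by congr (_ * _); exact: mxE.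
apply: eq_bigr => l _; rewrite (spray_homogeneous l Uz t0) expr2.
rewrite -(dy_phi_yscale l Uz t0).
by move: (dy l phi _) (spray F l z) => a b; ring.
Qed.

Lemma dy_co1_phi j z : U z -> F z * dy j c z = sc2 F c z * m_low F j z.
Proof.
move=> Uz; rewrite dy_sc2 //.
by rewrite (euler oU Uz (diff_co1_phi Uz) co1_phi_homogeneous) mul0r.
Qed.

Lemma delta_phi j z : U z ->
  delta F j phi z = c z * dy j F z + co2 F phi z * m_low F j z.
Proof. by move=> Uz; exact: (covector_frame (fun j => delta F j phi z) j Uz). Qed.

Lemma dx_phiE j z : dx j phi z =
  delta F j phi z + \sum_l dy j (spray F l) z * dy l phi z.
Proof. by rewrite /delta subrK. Qed.

(** This is [F_co1_phi] differentiated along $y^j$; the term $-\partial_j\phi$ is the free term of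
    [dy_ycontract] moved across. *)
Lemma y_dy_dx_phi j z : U z ->
  \sum_k ycoord k z * dy j (dx k phi) z =
  dy j F z * c z + sc2 F c z * m_low F j z - dx j phi z
  + 2 * (\sum_l (dy j (spray F l) z * dy l phi z
                 + spray F l z * dy j (dy l phi) z)).
Proof.
move=> Uz.
have := has_grad_dy j (has_grad_eq_on oU Uz (@F_co1_phi) (has_grad_F_co1 Uz)).
have D1 := has_gradM (has_grad_self (diff_F Uz)) (has_grad_self (diff_co1_phi Uz)).
rewrite (has_grad_dy j D1) !dyE (dy_co1_phi j Uz) => ->.
rewrite (@dy_ycontract _ (fun k => dx k phi)); last by move=> k; exact: diff_dx_phi.
rewrite mul0r add0r; move: (\sum_k _) (\sum_l _) => a b; ring.
Qed.

(** * Metric and spray of $\overline F$ *)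

Variable Fb : point -> R.
Hypotheses (FbE : forall w, U w -> Fb w = expR (phi w) * F w)
  (ndeg : forall z, U z -> sigma F phi z + eps F z - sc2 F phi z ^+ 2 != 0).

Lemma gmx_conformal i j z : U z ->
  gmx Fb z j i = expR (phi z) ^+ 2 *
    (dy j F z * dy i F z + q z * (dy j F z * m_low F i z + m_low F j z * dy i F z)
     + (sigma F phi z + eps F z) * m_low F j z * m_low F i z).
Proof.
move=> Uz; rewrite gmxE (dy_dy_conformal_sqr oU sF sphi FbE i j Uz).
rewrite (dyF2E i Uz) (dyF2E j Uz) /sigma.
have := dy_dy_phi i j Uz; have := gmxE F j i z; rewrite (gmx_frame j i Uz).
move: (dy_phi i Uz) (dy_phi j Uz) (F_neq0 Uz).
move: (expR _) (sc2 F q z) (q z) (main_scalar F z) => e q2 q1 I.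
atoms F z; exact: gmx_conformal_scalar.
Qed.

Lemma det_gmx_conformal z : U z -> \det (gmx Fb z) != 0.
Proof.
move=> Uz; rewrite det_mx2 (gmx_conformal 0 0 Uz) (gmx_conformal 0 1 Uz).
rewrite (gmx_conformal 1 0 Uz) (gmx_conformal 1 1 Uz).
have e0 : expR (phi z) != 0 by rewrite gt_eqF // expR_gt0.
move: (ndeg Uz) (lt0r_neq0 (vol_gt0 Uz)) (m_low_wedge Uz) e0.
move: (sigma F phi z) (expR _) (q z) => sg e q1.
atoms F z; exact: det_frame_neq0.
Qed.

Lemma spray_rhs_conformal j z : U z ->
  4^-1 * spray_rhs Fb j z = \sum_l gmx Fb z j l * spray F l z
  + 2^-1 * expR (phi z) ^+ 2 * F z ^+ 2 * (c z * dy j F z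
    + (2 * q z * c z + sc2 F c z - 2 * co2 F phi z) * m_low F j z).
Proof.
move=> Uz; rewrite /spray_rhs !sum_ord2 !gmxE.
rewrite (dy_dx_conformal_sqr oU sF sphi FbE 0 j Uz).
rewrite (dy_dx_conformal_sqr oU sF sphi FbE 1 j Uz).
rewrite (dy_dy_conformal_sqr oU sF sphi FbE 0 j Uz).
rewrite (dy_dy_conformal_sqr oU sF sphi FbE 1 j Uz).
rewrite (dx_conformal_sqr oU sF sphi FbE j Uz).
rewrite !(dyF2E _ Uz).
have hS := F_co1_phi Uz; have hB := sum_y_dxF2 Uz.
have hC := y_dy_dx_phi j Uz; have hD := spray_system_F j Uz.
rewrite /spray_rhs in hD; rewrite !sum_ord2 in hS hB hC; rewrite !sum_ord2 in hD.
have hx := dx_phiE j z; rewrite (delta_phi j Uz) sum_ord2 in hx.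
move: hS hB hC hD hx (dy_phi j Uz) (gmxE F j 0 z) (gmxE F j 1 z).
move: (expR _) (sc2 F c z) (c z) (co2 F phi z) (q z) => e c2 c1 k q1.
move: (spray F 0 z) (spray F 1 z) => G0 G1.
atoms F z; exact: spray_rhs_conformal_scalar.
Qed.

Lemma spray_conformal i z : U z ->
  let Q := Qcoef F phi z in
  spray Fb i z = spray F i z + Q * m_up F i z
    + (2^-1 * F z ^+ 2 * co1 F phi z - eps F z * sc2 F phi z * Q) * ell_up F i z.
Proof.
move=> Uz Q; pose P := 2^-1 * F z ^+ 2 * co1 F phi z - eps F z * sc2 F phi z * Q.
(* The claimed value is tested in the linear system of [Fb], whose matrix is invertible by
   [det_gmx_conformal]. *)
apply: (spray_unique (X := fun i => spray F i z + Q * m_up F i z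
  + P * ell_up F i z) (det_gmx_conformal Uz)) => {}i.
rewrite spray_rhs_conformal // !sum_ord2.
rewrite (gmx_conformal 0 i Uz) (gmx_conformal 1 i Uz).
have lu : dy 0 F z * m_up F 0 z + dy 1 F z * m_up F 1 z = 0.
  rewrite (m_up0 Uz) (m_up1 Uz).
  by atoms F z; ring.
have mu : m_low F 0 z * m_up F 0 z + m_low F 1 z * m_up F 1 z = eps F z.
  rewrite (m_up0 Uz) (m_up1 Uz).
  move: (lt0r_neq0 (vol_gt0 Uz)) (m_low_wedge Uz).
  by atoms F z; exact: wedge_div.
have ll : dy 0 F z * ell_up F 0 z + dy 1 F z * ell_up F 1 z = 1.
  rewrite /ell_up; move: (F_neq0 Uz) (euler_F Uz); atoms F z => f0 h.
  by rewrite !mulrA -mulrDl -(mulfV f0) -{2}h; ring.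
have ml : m_low F 0 z * ell_up F 0 z + m_low F 1 z * ell_up F 1 z = 0.
  by rewrite m_low0 m_low1 /ell_up; atoms F z; ring.
have hQ : Q = 2^-1 * (eps F z * (sigma F phi z + eps F z - q z ^+ 2)^-1
  * F z ^+ 2 * (q z * c z + sc2 F c z - 2 * co2 F phi z)) by [].
have hP : P = 2^-1 * F z ^+ 2 * c z - eps F z * q z * Q by [].
clearbody P; clearbody Q.
move: (ndeg Uz) (sqr_eps Uz) lu mu ll ml hQ hP.
move: (expR _) (sc2 F c z) (c z) (co2 F phi z) (q z) (sigma F phi z)
  => e c2 c1 k q1 sg.
move: (spray F 0 z) (spray F 1 z) (m_up F 0 z) (m_up F 1 z)
  (ell_up F 0 z) (ell_up F 1 z) => G0 G1 u0 u1 v0 v1.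
atoms F z; exact: spray_conformal_scalar.
Qed.

End Conformal.

End Frame.

(** * Passage from $TM$ to induced coordinates *)

Section Charts.
Context (R : realType) (M : topologicalType) (S : surface R M).
Variables (A : set (tangent S)) (a : cidx S).
Hypothesis scA : forall v (t : R), A v -> 0 < t -> A (tscale t v).

Lemma yconic_coord_set : yconic (coord_set a A).
Proof.
by move=> _ t [v [Av av] <-] t0; exists (tscale t v) => //; split=> //; exact: scA.
Qed.

Lemma coord_fun_homogeneous r (f : tangent S -> R) :
  homogeneous_TM A r f -> homogeneous_on (coord_set a A) r (coord_fun a f).
Proof.
move=> hf _ t [v [Av av] <-] t0.
(* In a chart, scaling a tangent vector is by definition the dilation in $y$. *)
by rewrite -[yscale _ _]/(tcoord a (tscale t v)) !coord_funE // hf.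
Qed.

End Charts.

Theorem theorem3p7 (R : realType) (M : topologicalType) (S : surface R M)
    (A : set (tangent S)) (F phi : tangent S -> R)
    (F_finsler : conic_pseudo_finsler A F)
    (F_neq0 : forall v, A v -> F v != 0)
    (phi_smooth : smooth_TM A phi)
    (phi_homogeneous : homogeneous_TM A 0 phi)
    (phi_nondegenerate : forall (a : cidx S) z, coord_set a A z ->
       let Fa := coord_fun a F in
       let phia := coord_fun a phi in
       sigma Fa phia z + eps Fa z - sc2 Fa phia z ^+ 2 != 0) :
  let Fbar := fun v => expR (phi v) * F v in
  forall (a : cidx S) (z : 'rV[R]_2 * 'rV[R]_2) (i : 'I_2), coord_set a A z ->
    let Fa := coord_fun a F in
    let phia := coord_fun a phi in
    let Q := Qcoef Fa phia z in
    spray (coord_fun a Fbar) i z =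
      spray Fa i z + Q * m_up Fa i z
      + (2^-1 * Fa z ^+ 2 * co1 Fa phia z - eps Fa z * sc2 Fa phia z * Q)
        * ell_up Fa i z.
Proof.
move=> Fbar a z i Uz Fa phia Q.
have [sub smF homF detF] := F_finsler.
pose U := coord_set a A.
have cU : yconic U by apply: yconic_coord_set; exact: conic_scale sub.
have F0 w : U w -> coord_fun a F w != 0.
  by move=> [v [Av av] <-]; rewrite coord_funE // F_neq0.
(* Points of [U] are coordinates of vectors in [A], where [coord_fun] takes its true value and not
   the default [0]. *)
have FbE w : U w ->
    coord_fun a Fbar w = expR (coord_fun a phi w) * coord_fun a F w.
  by move=> [v [Av av] <-]; rewrite !coord_funE.
have oU : open U by exact: (conic_open sub).
exact: (spray_conformal oU cU (smF a)
  (coord_fun_homogeneous homF) F0 (detF a) (phi_smooth a)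
  (coord_fun_homogeneous phi_homogeneous) FbE (phi_nondegenerate a) i Uz).
Qed.
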